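(* Let $p\ge3$, $X\mid\theta\sim N_p(\theta,D)$ with $D=\operatorname{diag}(d_1,\ldots,d_p)$, $d_j>0$, and let the prior be $\theta\sim N(0,\Gamma)$ with $\Gamma=\operatorname{diag}(\gamma_1,\ldots,\gamma_p)$, $\gamma_j\ge0$. Let $d_j^*=d_j^2/(d_j+\gamma_j)$ with indices sorted so that $d_1^*\ge\cdots\ge d_p^*$. Let $A^\dagger=\operatorname{diag}(a_1^\dagger,\ldots,a_p^\dagger)$ be the unique maximizer of $c^*(D,A)=\sum_j d_ja_j-2\max_j d_ja_j$ over $a_j\ge0$ with $\sum_j(d_j+\gamma_j)a_j^2=\sum_j d_j^*$, let $\nu$ be the largest index with $d_\nu a_\nu^\dagger=\max_j d_ja_j^\dagger$, and let $\delta_{A^\dagger(\Gamma)}(X)=X-\frac{c^*(D,A^\dagger)}{X^\top A^{\dagger\top}A^\dagger X}A^\dagger X$. Denote by $R(\delta,\pi_\Gamma)=E^{\pi_\Gamma}E_\theta\|\delta(X)-\theta\|^2$ the Bayes risk. If $\nu=3$, then \[ R\{\delta_{A^\dagger(\Gamma)},\pi_\Gamma\}\le\operatorname{tr}(D)-\sum_{j=3}^p d_j^*+\Big(d_3^*-\frac{2}{p-2}\sum_{j=4}^pd_j^*-\frac{p}{p-2}\frac{d_3^*}{3}\Big)\le\operatorname{tr}(D)-\sum_{j=3}^p d_j^*+\frac23d_3^*. \] If $\nu\ge4$, then \[ R\{\delta_{A^\dagger(\Gamma)},\pi_\Gamma\}\le\operatorname{tr}(D)-\sum_{j=3}^p d_j^*+\Big(d_3^*+d_4^*-\frac{2}{p-2}\sum_{j=5}^pd_j^*-\frac{4p}{p-2}\frac{d_\nu^*}{\nu}\Big)\le\operatorname{tr}(D)-\sum_{j=3}^p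 d_j^*+(d_3^*+d_4^* ). \]
   Context: The maximizer $A^\dagger$ exists and is unique. An empty summation is $0$. $E^{\pi_\Gamma}$ denotes expectation over $\theta\sim N(0,\Gamma)$ and $E_\theta$ expectation over $X\sim N(\theta,D)$. *)

(* Defs.v *)
From HB Require Import structures.
From mathcomp Require Import all_boot all_order all_algebra.
From mathcomp Require Import all_classical all_reals all_analysis.
Set Implicit Arguments. Unset Strict Implicit. Unset Printing Implicit Defensive.
Import Order.TTheory GRing.Theory Num.Theory.
Local Open Scope ring_scope.

(* Vectors of R^p are represented as functions nat -> R, coordinates 1..p
   (coordinate 0 and coordinates > p are unused). *)

(* Expectation of a nonnegative (extended-real valued) functional of a scalar
   Y ~ N(m, v) (v = variance >= 0).  For v = 0 the distribution is the point
   mass at m, so the expectation is F m. *)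
Definition gauss_int {R : realType} (m v : R) (F : R -> \bar R) : \bar R :=
  if v == 0 then F m
  else (\int[normal_prob m (Num.sqrt v)]_y F y)%E.

Definition vset {R : realType} (x : nat -> R) (j : nat) (y : R) : nat -> R :=
  fun i => if i == j then y else x i.

(* Expectation of F(Y) for Y = (Y_1,...,Y_n) with independent coordinates
   Y_j ~ N(mu j, v j): iterated integral over coordinates n, n-1, ..., 1
   (Tonelli: equal to the product-measure integral for nonnegative F). *)
Fixpoint gauss_vec_int {R : realType} (n : nat) (mu v : nat -> R)
  (F : (nat -> R) -> \bar R) : \bar R :=
  match n with
  | 0 => F (fun _ => 0)
  | k.+1 => gauss_int (mu k.+1) (v k.+1)
              (fun y => gauss_vec_int k mu v (fun x => F (vset x k.+1 y)))
  end.

Definition maxda {R : realType} (p : nat) (d a : nat -> R) : R :=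
  \big[Num.max/0]_(1 <= j < p.+1) (d j * a j).

Definition cstar {R : realType} (p : nat) (d a : nat -> R) : R :=
  \sum_(1 <= j < p.+1) d j * a j - 2 * maxda p d a.

Definition dstar {R : realType} (d g : nat -> R) (j : nat) : R :=
  d j ^+ 2 / (d j + g j).

Definition feasible {R : realType} (p : nat) (d g a : nat -> R) : Prop :=
  (forall j, (1 <= j <= p)%N -> 0 <= a j) /\
  \sum_(1 <= j < p.+1) (d j + g j) * a j ^+ 2 = \sum_(1 <= j < p.+1) dstar d g j.

Definition is_maximizer {R : realType} (p : nat) (d g a : nat -> R) : Prop :=
  feasible p d g a /\
  forall b, feasible p d g b -> cstar p d b <= cstar p d a.

Definition is_nu {R : realType} (p : nat) (d a : nat -> R) (nu : nat) : Prop :=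
  (1 <= nu <= p)%N /\ d nu * a nu = maxda p d a /\
  forall j, (nu < j <= p)%N -> d j * a j != maxda p d a.

Definition delta {R : realType} (p : nat) (d a : nat -> R) (x : nat -> R)
  : nat -> R :=
  fun j => x j - cstar p d a / (\sum_(1 <= i < p.+1) (a i * x i) ^+ 2) * (a j * x j).

Definition bayes_risk {R : realType} (p : nat) (d g : nat -> R)
  (est : (nat -> R) -> (nat -> R)) : \bar R :=
  gauss_vec_int p (fun _ => 0) g (fun theta =>
    gauss_vec_int p theta d (fun x =>
      (\sum_(1 <= j < p.+1) (est x j - theta j) ^+ 2)%:E)).

(* Main.v *)
(* Stein's identity gives E_theta |delta - theta|^2 <= tr D - c^2 E_theta(1/S)
   with c = cstar and S = X^T A^T A X.  Under the prior, X_j / sqrt(d_j + g_j) are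
   i.i.d. standard normal; by exchangeability and Jensen's inequality E(1/S) is at
   least its value p / ((p - 2) W) for equal weights, W = sum_j (d_j + g_j) a_j^2,
   so the Bayes risk is at most tr D - p / (p - 2) c^2 / W.  All Stein identities
   are applied to the bounded regularizations 1 / (S + eps), and Fatou's lemma
   removes eps.

   For the maximizer, one-coordinate variations give d_j a_j = M for j <= nu and
   d_j a_j = (W / c) dstar_j for j > nu.  With Q = sum_(j <= nu) 1 / dstar_j this
   yields c^2 / W = (nu - 2)^2 / Q + sum_(j > nu) dstar_j and
   dstar_nu Q >= nu - 2, and the stated bounds follow by comparing averages of the
   sorted dstar_j with their harmonic mean nu / Q. *)
Require Import Defs.
From HB Require Import structures.
From mathcomp Require Import all_boot all_order all_algebra.
From mathcomp Require Import all_classical all_reals all_analysis.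
From mathcomp Require Import measurable_realfun.
From mathcomp Require Import ring lra.
Import Order.TTheory GRing.Theory Num.Theory.
Import numFieldNormedType.Exports HBNNSimple.
Local Open Scope classical_set_scope.
Local Open Scope ring_scope.

(** * The maximizer *)

(** The marginal law of [X] is never computed. Parameter and noise live on one probability space;
    each coordinate of either satisfies a Stein identity, with factor [g j] or [d j], and the sum of
    the two is the identity for [X] with factor [d j + g j]. Every fact about inverse quadratic
    forms is extracted from these identities: the bound E(1/N) >= 1/(p - 2) for the standardized
    squared length N needs no chi-square density, and exchangeability means only that certain
    integrals do not depend on the coordinate, which follows by using Stein's identity in two
    coordinates in either order. Zero prior variances are absorbed in dimension one, since a point
    mass is an affine image, with slope 0, of the standard normal law. For the maximizer the
    obstacles are the curved constraint and the maximum in [cstar], which is not differentiable.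
    Homogeneity removes the former; one-sided variations replace the Lagrange conditions for the
    latter, and [W / c] is the multiplier. *)

Lemma ler_sum_indexn (R : realType) (m n : nat) (F G : nat -> R) :
  (forall j, (m <= j < n)%N -> F j <= G j) ->
  \sum_(m <= j < n) F j <= \sum_(m <= j < n) G j.
Proof.
by move=> FG; rewrite !big_nat; apply: ler_sum => j; exact: FG.
Qed.

Lemma sumr_indexn_gt0 (R : realType) (m n : nat) (F : nat -> R) : (m < n)%N ->
  (forall j, (m <= j < n)%N -> 0 < F j) -> 0 < \sum_(m <= j < n) F j.
Proof.
move=> mn F0; rewrite big_ltn// ltr_wpDr ?F0 ?leqnn//.
by rewrite big_nat sumr_ge0// => j /andP[mj jn]; rewrite ltW// F0// jn ltnW.
Qed.

Lemma dstar_gt0 (R : realType) (d g : nat -> R) j :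
  0 < d j -> 0 <= g j -> 0 < dstar d g j.
Proof. by move=> dj gj; rewrite divr_gt0 ?exprn_gt0 ?ltr_wpDr. Qed.

Lemma maxda_ge0 (R : realType) p (d a : nat -> R) : 0 <= maxda p d a.
Proof. by rewrite /maxda; elim/big_rec: _ => // i x _ x0; rewrite le_max x0 orbT. Qed.

Lemma maxda_ub (R : realType) p (d a : nat -> R) j :
  (1 <= j <= p)%N -> d j * a j <= maxda p d a.
Proof.
move=> jp; rewrite /maxda.
by apply: (le_bigmax_seq 0 j xpredT (fun i => d i * a i)); rewrite // mem_index_iota ltnS.
Qed.

Lemma maxda_le (R : realType) p (d a : nat -> R) (M : R) : 0 <= M ->
  (forall j, (1 <= j <= p)%N -> d j * a j <= M) -> maxda p d a <= M.
Proof.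
move=> M0 aM; rewrite /maxda big_nat; elim/big_ind: _ => // x y xM yM.
by rewrite ge_max xM.
Qed.

Lemma cstarZ (R : realType) p (d b : nat -> R) (k : R) : 0 <= k ->
  cstar p d (fun j => k * b j) = k * cstar p d b.
Proof.
move=> k0; rewrite /cstar /maxda mulrBr mulr_sumr.
under eq_bigr do rewrite mulrCA.
congr (_ - _); rewrite mulrCA; congr (_ * _).
under eq_bigr do rewrite mulrCA.
elim: (index_iota 1 p.+1) => [|x l IH]; first by rewrite !big_nil mulr0.
by rewrite !big_cons IH maxr_pMr.
Qed.

Section maximizer.
Context (R : realType) (p : nat) (d g a : nat -> R).
Hypothesis hp : (3 <= p)%N.
Hypothesis hd : forall j, (1 <= j <= p)%N -> 0 < d j.
Hypothesis hg : forall j, (1 <= j <= p)%N -> 0 <= g j.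
Hypothesis ha : is_maximizer p d g a.

Let W := \sum_(1 <= j < p.+1) dstar d g j.
Let c := cstar p d a.
Let M := maxda p d a.

Let p1 : (1 <= 1 <= p)%N. Proof. by rewrite (leq_trans _ hp). Qed.

Let d_neq0 j : (1 <= j <= p)%N -> d j != 0.
Proof. by move=> /hd; exact: lt0r_neq0. Qed.

Let s_gt0 j : (1 <= j <= p)%N -> 0 < d j + g j.
Proof. by move=> jp; rewrite ltr_wpDr ?hg// hd. Qed.

Let s_neq0 j : (1 <= j <= p)%N -> d j + g j != 0.
Proof. by move=> /s_gt0; exact: lt0r_neq0. Qed.

Let ds_gt0 j : (1 <= j <= p)%N -> 0 < dstar d g j.
Proof. by move=> jp; rewrite dstar_gt0 ?hd ?hg. Qed.

Let a_ge0 j : (1 <= j <= p)%N -> 0 <= a j. Proof. by case: ha => -[+ _] _; exact. Qed.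

Let WE : \sum_(1 <= j < p.+1) (d j + g j) * a j ^+ 2 = W.
Proof. by case: ha => -[_ +] _. Qed.

Lemma sum_dstar_gt0 : 0 < W.
Proof.
by apply: sumr_indexn_gt0 => // j; exact: ds_gt0.
Qed.

(** [cstar] is positively homogeneous, so any nonzero point of the orthant can be rescaled onto the
    constraint ellipsoid and compared there with [a]. *)
Lemma cstar_scaled_le b : (forall j, (1 <= j <= p)%N -> 0 <= b j) ->
  let B := \sum_(1 <= j < p.+1) (d j + g j) * b j ^+ 2 in
  0 < B -> exists k, [/\ 0 < k, k ^+ 2 * B = W & k * cstar p d b <= c].
Proof.
move=> b0 B B0; exists (Num.sqrt (W / B)).
have kB : Num.sqrt (W / B) ^+ 2 * B = W.
  by rewrite sqr_sqrtr ?divfK ?gt_eqF// ltW// divr_gt0// sum_dstar_gt0.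
split=> //; first by rewrite sqrtr_gt0 divr_gt0// sum_dstar_gt0.
rewrite -cstarZ ?sqrtr_ge0//; apply: (proj2 ha); split.
  by move=> j jp; rewrite mulr_ge0 ?sqrtr_ge0 ?b0.
rewrite -/W -[RHS]kB mulr_sumr; apply: eq_bigr => j _.
by rewrite exprMn mulrCA.
Qed.

(** The point [(d j)^-1] makes all products [d j * b j] equal to 1; its value is at least [p - 2],
    which is positive because [3 <= p]. *)
Lemma cstar_gt0 : 0 < c.
Proof.
have b0 j : (1 <= j <= p)%N -> 0 <= (d j)^-1 by move=> jp; rewrite invr_ge0 ltW// hd.
have [|k [k0 _]] := @cstar_scaled_le _ b0.
  apply: sumr_indexn_gt0 => // j jp.
  by rewrite mulr_gt0 ?s_gt0 ?exprn_gt0 ?invr_gt0 ?hd.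
apply: lt_le_trans; rewrite mulr_gt0// /cstar.
have -> : \sum_(1 <= j < p.+1) d j * (d j)^-1 = p%:R.
  rewrite big_nat (eq_bigr (fun=> 1)) -?big_nat; last by move=> j jp; rewrite divff ?d_neq0.
  by rewrite big_const_nat subSS subn0 iter_addr addr0.
have : maxda p d (fun j => (d j)^-1) <= 1.
  by apply: maxda_le => // j jp; rewrite divff// d_neq0.
have : (3 : R) <= p%:R by rewrite ler_nat.
lra.
Qed.

(* AM-GM turns the homogeneous inequality c(b) sqrt W <= c(a) sqrt(sum s b^2)
   into one that is polynomial in b. *)
Lemma cstar_tangent b : (forall j, (1 <= j <= p)%N -> 0 <= b j) ->
  2 * W * cstar p d b <= c * (W + \sum_(1 <= j < p.+1) (d j + g j) * b j ^+ 2).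
Proof.
move=> b0; set B := \sum_(_ <= _ < _) _.
have W0 := sum_dstar_gt0; have c0 := cstar_gt0.
have B0 : 0 <= B.
  by rewrite /B big_nat sumr_ge0// => j jp; rewrite mulr_ge0 ?sqr_ge0// ltW// s_gt0.
have [cb0|cb0] := leP (cstar p d b) 0.
  apply: (@le_trans _ _ 0).
    by rewrite mulr_ge0_le0// mulr_ge0// ltW.
  by rewrite mulr_ge0 ?(ltW c0)// addr_ge0// ltW.
move: B0; rewrite le_eqVlt => /predU1P[B0|B0].
  suff : cstar p d b <= 0 by lra.
  rewrite /cstar.
  have bz j : (1 <= j <= p)%N -> b j = 0.
    move=> jp; apply/eqP; rewrite -sqrf_eq0.
    have : \sum_(1 <= j < p.+1 | (1 <= j <= p)%N) (d j + g j) * b j ^+ 2 = 0.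
      by rewrite -big_nat -/B -B0.
    move/eqP; rewrite psumr_eq0; last first.
      by move=> i ip; rewrite mulr_ge0 ?sqr_ge0// ltW// s_gt0.
    move/allP/(_ j); rewrite mem_index_iota ltnS jp => /(_ isT)/=.
    by rewrite mulf_eq0 (negbTE (s_neq0 _ jp)).
  rewrite big_nat big1 => [|j jp]; last by rewrite bz ?mulr0.
  by have := maxda_ge0 _ p d b; lra.
have [k [k0 kB kc]] := cstar_scaled_le b b0 B0; rewrite -/B in kB.
have -> : 2 * W * cstar p d b = 2 * k * B * (k * cstar p d b) by rewrite -kB; ring.
apply: (@le_trans _ _ (2 * k * B * c)).
  by rewrite ler_wpM2l// mulr_ge0 ?(ltW B0)// mulr_ge0// ltW.
rewrite [leRHS]mulrC ler_wpM2r ?(ltW c0)// -kB -subr_ge0.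
have -> : k ^+ 2 * B + B - 2 * k * B = (k - 1) ^+ 2 * B by ring.
by rewrite mulr_ge0 ?sqr_ge0// ltW.
Qed.

(** First-order optimality: [cstar_tangent] is an equality at [a], so the linear terms along
    [a + h * z] must be ordered, the quadratic remainder being of order [h] after division by [h].
    Only a lower slope [l] of [cstar] is asked for, as the maximum in it has no derivative in
    general. *)
Lemma cstar_variation (z : nat -> R) (l h0 : R) : 0 < h0 ->
  (forall h, 0 < h <= h0 -> (forall j, (1 <= j <= p)%N -> 0 <= a j + h * z j) /\
     c + h * l <= cstar p d (fun j => a j + h * z j)) ->
  W * l <= c * \sum_(1 <= j < p.+1) (d j + g j) * (a j * z j).
Proof.
move=> h00 hz; set B1 := \sum_(_ <= _ < _) _.
pose C := \sum_(1 <= j < p.+1) (d j + g j) * z j ^+ 2.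
have C0 : 0 <= C.
  by rewrite /C big_nat sumr_ge0// => j jp; rewrite mulr_ge0 ?sqr_ge0// ltW// s_gt0.
have W0 := sum_dstar_gt0; have c0 := cstar_gt0.
have key h : 0 < h <= h0 -> 2 * (W * l - c * B1) <= h * (c * C).
  move=> hh; have [az lz] := hz _ hh; have /andP[hp0 _] := hh.
  have := cstar_tangent _ az.
  have -> : \sum_(1 <= j < p.+1) (d j + g j) * (a j + h * z j) ^+ 2
      = W + 2 * h * B1 + h ^+ 2 * C.
    rewrite -WE /B1 /C !mulr_sumr -!big_split/=; apply: eq_bigr => j _; ring.
  move=> t; rewrite -(ler_pM2l hp0).
  have : 2 * W * (c + h * l) <= c * (W + (W + 2 * h * B1 + h ^+ 2 * C)).
    by apply: le_trans t; rewrite ler_wpM2l// mulr_ge0// ltW.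
  lra.
rewrite leNgt; apply/negP => lt.
pose e := W * l - c * B1.
have e0 : 0 < e by rewrite subr_gt0.
have cC0 : 0 <= c * C by rewrite mulr_ge0// ltW.
have cC1 : 0 < c * C + 1 by rewrite ltr_wpDl.
have := key (Num.min h0 (e / (c * C + 1))).
rewrite lt_min h00 divr_gt0//= ge_min lexx => /(_ isT).
have : Num.min h0 (e / (c * C + 1)) * (c * C) <= e / (c * C + 1) * (c * C).
  by rewrite ler_wpM2r// ge_min lexx orbT.
have : e / (c * C + 1) * (c * C) <= e.
  rewrite mulrAC ler_pdivrMr// ler_wpM2l ?(ltW e0)//; lra.
rewrite -/e; lra.
Qed.

(** The factor [(d j)^-1] makes the sum of the [d i * a i] move by exactly [t]. *)
Let pert (j : nat) (t : R) i := a i + t * (if i == j then (d j)^-1 else 0).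

Let sum_pert j t : (1 <= j <= p)%N ->
  \sum_(1 <= i < p.+1) d i * pert j t i = \sum_(1 <= i < p.+1) d i * a i + t.
Proof.
move=> jp; rewrite /pert.
under eq_bigr do rewrite mulrDr.
rewrite big_split/=; congr (_ + _).
rewrite (bigD1_seq j) ?iota_uniq ?mem_index_iota ?ltnS//= eqxx big1 ?addr0.
  by rewrite mulrCA divff ?mulr1// d_neq0.
by move=> i /negbTE ->; rewrite !mulr0.
Qed.

Let sum_pert1 j t : (1 <= j <= p)%N ->
  \sum_(1 <= i < p.+1) (d i + g i) * (a i * (t * (if i == j then (d j)^-1 else 0)))
  = t * (d j * a j / dstar d g j).
Proof.
move=> jp.
rewrite (bigD1_seq j) ?iota_uniq ?mem_index_iota ?ltnS//= eqxx big1 ?addr0.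
  by rewrite /dstar; field; rewrite d_neq0 ?s_neq0.
by move=> i /negbTE ->; rewrite !mulr0.
Qed.

(** Lowering [d j * a j] by [h] costs at most [h], because the maximum cannot rise. There is no room
    to lower when [a j = 0], but then the bound is trivial. *)
Lemma maximizer_le j : (1 <= j <= p)%N -> d j * a j <= W / c * dstar d g j.
Proof.
move=> jp; have c0 := cstar_gt0; have W0 := sum_dstar_gt0.
have := a_ge0 _ jp; rewrite le_eqVlt => /predU1P[<-|aj0].
  by rewrite mulr0 mulr_ge0 ?(ltW (ds_gt0 _ jp))// divr_ge0// ltW.
have := @cstar_variation (fun i => -1 * (if i == j then (d j)^-1 else 0)) (- 1) (d j * a j).
rewrite mulr_gt0 ?hd// => /(_ isT).
rewrite sum_pert1// => H.
suff : W * -1 <= c * (-1 * (d j * a j / dstar d g j)).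
  rewrite !mulN1r mulrN1 mulrN lerN2 mulrA => h.
  by rewrite mulrAC ler_pdivlMr// -ler_pdivrMr ?ds_gt0// (mulrC (d j * a j)).
apply: H => h /andP[h0 hle]; split=> [i ip|].
  case: eqVneq => [->|_]; last by rewrite !mulr0 addr0 a_ge0.
  by rewrite mulN1r mulrN subr_ge0 ler_pdivrMr ?hd// mulrC.
rewrite mulrN1.
have -> : (fun i => a i + h * (-1 * (if i == j then (d j)^-1 else 0))) = pert j (- h).
  by apply/funext => i; rewrite /pert mulrA mulrN1.
rewrite /c /cstar sum_pert// addrAC lerD2l lerN2 ler_wpM2l//.
apply: maxda_le; first exact: maxda_ge0.
move=> i ip; apply: le_trans (maxda_ub _ _ d a _ ip).
rewrite ler_wpM2l ?(ltW (hd _ ip))// /pert; case: eqVneq => _; last by rewrite mulr0 addr0.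
by rewrite gerDl mulNr oppr_le0 mulr_ge0 ?invr_ge0 ?(ltW (hd _ jp))// ltW.
Qed.

(** Raising [d j * a j] by [h] gains [h] as long as it stays below the maximum, hence the range
    [M - d j * a j] for [h]. *)
Lemma maximizer_eq j : (1 <= j <= p)%N -> d j * a j < M ->
  d j * a j = W / c * dstar d g j.
Proof.
move=> jp ltM; apply/eqP; rewrite eq_le maximizer_le//=.
have c0 := cstar_gt0; have W0 := sum_dstar_gt0.
have := @cstar_variation (fun i => 1 * (if i == j then (d j)^-1 else 0)) 1 (M - d j * a j).
rewrite subr_gt0 => /(_ ltM); rewrite sum_pert1// => H.
suff : W * 1 <= c * (1 * (d j * a j / dstar d g j)).
  by rewrite mulr1 mul1r mulrA ler_pdivlMr ?ds_gt0// mulrAC ler_pdivrMr// (mulrC c).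
apply: H => h /andP[h0 hle]; split=> [i ip|].
  by rewrite addr_ge0 ?a_ge0// mul1r mulr_ge0 ?(ltW h0)//; case: ifP; rewrite // invr_ge0 ltW// hd.
rewrite mulr1.
have -> : (fun i => a i + h * (1 * (if i == j then (d j)^-1 else 0))) = pert j h.
  by apply/funext => i; rewrite /pert mul1r.
rewrite /c /cstar sum_pert// addrAC lerD2l lerN2 ler_wpM2l//.
apply: maxda_le; first exact: maxda_ge0.
move=> i ip; rewrite /pert; case: eqVneq => [->|_]; last by rewrite mulr0 addr0 maxda_ub.
rewrite mulrDr mulrCA divff ?d_neq0// mulr1; rewrite -/M; lra.
Qed.

Section nu.
Context (nu : nat).
Hypothesis hsort : forall i j, (1 <= i)%N -> (i <= j)%N -> (j <= p)%N ->
  dstar d g j <= dstar d g i.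
Hypothesis hnu : is_nu p d a nu.

Let Q := \sum_(1 <= j < nu.+1) (dstar d g j)^-1.
Let T := \sum_(nu.+1 <= j < p.+1) dstar d g j.

Let nup : (1 <= nu <= p)%N. Proof. by case: hnu. Qed.

(** If [d j * a j] were below [M], it would equal [W / c * dstar d g j], which by sorting is at
    least [W / c * dstar d g nu], hence at least [M]. *)
Lemma maximizer_head j : (1 <= j <= nu)%N -> d j * a j = M.
Proof.
move=> /andP[j1 jnu]; have /andP[nu1 nu2] := nup.
have jp : (1 <= j <= p)%N by rewrite j1 (leq_trans jnu).
apply/eqP; rewrite eq_le maxda_ub//= leNgt; apply/negP => ltM.
have := ltM; rewrite maximizer_eq// => ltM'.
have := maximizer_le _ nup; have [_ [-> _]] := hnu.
rewrite -/M => Mnu.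
have : W / c * dstar d g nu <= W / c * dstar d g j.
  by rewrite ler_wpM2l ?hsort// divr_ge0// ltW ?cstar_gt0 ?sum_dstar_gt0.
lra.
Qed.

Lemma maximizer_tail j : (nu < j <= p)%N -> d j * a j = W / c * dstar d g j.
Proof.
move=> jp; have /andP[nu1 nu2] := nup; have /andP[nj jp'] := jp.
have j1 : (1 <= j <= p)%N by rewrite jp' (leq_ltn_trans _ nj).
apply: maximizer_eq => //; rewrite lt_neqAle maxda_ub// andbT.
by have [_ [_ /(_ _ jp)]] := hnu.
Qed.

Lemma cstar_maximizer :
  c ^+ 2 / W = (nu%:R - 2) ^+ 2 / Q + T /\ nu%:R - 2 <= dstar d g nu * Q.
Proof.
have c0 := cstar_gt0; have W0 := sum_dstar_gt0; have /andP[nu1 nu2] := nup.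
pose la := W / c; have la0 : 0 < la by rewrite divr_gt0.
have M0 : 0 < M.
  rewrite lt_neqAle maxda_ge0 andbT; apply/eqP => M0; move: c0.
  rewrite /c /cstar -/M -M0 mulr0 subr0 ltNge => /negP; apply.
  by rewrite big_nat sumr_le0// => j jp; rewrite M0 maxda_ub.
have Q0 : 0 < Q.
  apply: sumr_indexn_gt0 => // j /andP[j1 jn].
  by rewrite invr_gt0 ds_gt0// j1 (leq_trans _ nu2).
have cE : c = (nu%:R - 2) * M + la * T.
  have head : \sum_(1 <= j < nu.+1) d j * a j = nu%:R * M.
    transitivity (\sum_(1 <= j < nu.+1) M).
      by apply: eq_big_nat => j; exact: maximizer_head.
    by rewrite big_const_nat subSS subn0 iter_addr addr0 mulr_natl.
  have tail : \sum_(nu.+1 <= j < p.+1) d j * a j = la * T.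
    by rewrite /T mulr_sumr; apply: eq_big_nat => j; exact: maximizer_tail.
  rewrite {1}/c /cstar -/M (big_cat_nat (n := nu.+1))//= head tail; ring.
have sE j : (1 <= j <= p)%N -> (d j + g j) * a j ^+ 2 = (d j * a j) ^+ 2 / dstar d g j.
  by move=> jp; rewrite /dstar; field; rewrite d_neq0 ?s_neq0.
have WE' : W = M ^+ 2 * Q + la ^+ 2 * T.
  rewrite -{1}WE (big_cat_nat (n := nu.+1))//=; congr (_ + _).
    rewrite /Q mulr_sumr big_nat [RHS]big_nat; apply: eq_bigr => j /andP[j1 jn].
    by rewrite sE ?maximizer_head ?j1// (leq_trans _ nu2).
  rewrite /T mulr_sumr big_nat [RHS]big_nat; apply: eq_bigr => j /andP[nj jp].
  have j1p : (1 <= j <= p)%N by rewrite (leq_ltn_trans _ nj).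
  by rewrite sE// maximizer_tail ?nj// /la; field; rewrite !gt_eqF ?ds_gt0.
have Wla : W = la * c by rewrite /la divfK ?gt_eqF.
(* Both expressions for [W], namely [la * c] expanded by [cE] and [WE'], contain [la ^+ 2 * T]; it
   cancels, and a factor [M] divides out. *)
have laM : la * (nu%:R - 2) = M * Q.
  apply: (mulIf (lt0r_neq0 M0)); move: WE'; rewrite Wla {1}cE; lra.
split.
  have ME : M = la * (nu%:R - 2) / Q by rewrite laM mulfK ?gt_eqF.
  rewrite Wla expr2 -mulf_div divff ?gt_eqF// mulr1.
  rewrite [X in X / la]cE ME; field; by rewrite !gt_eqF.
have := maximizer_le _ nup; have [_ [-> _]] := hnu.
rewrite -/M -/la => Mla.
by rewrite -(ler_pM2l la0) laM mulrA ler_wpM2r// ltW.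
Qed.

End nu.
End maximizer.

(** * Sorted sequences and their harmonic mean *)

Lemma sorted_sum_le_harmonic (R : realType) (e : nat -> R) (n : nat) :
  (4 <= n)%N -> (forall j, (1 <= j <= n)%N -> 0 < e j) ->
  (forall i j, (1 <= i)%N -> (i <= j)%N -> (j <= n)%N -> e j <= e i) ->
  let Q := \sum_(1 <= j < n.+1) (e j)^-1 in
  n%:R - 2 <= e n * Q ->
  4 * (e n / n%:R) + \sum_(5 <= j < n.+1) e j <= (n%:R - 2) ^+ 2 / Q.
Proof.
move=> n4 e0 es Q enQ.
have n0 : 0 < n%:R :> R by rewrite ltr0n (leq_trans _ n4).
have n4R : 4 <= n%:R :> R by rewrite ler_nat.
have en0 : 0 < e n by rewrite e0// leqnn andbT (leq_trans _ n4).
have Q0 : 0 < Q.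
  by apply: sumr_indexn_gt0 => [|j jn]; rewrite ?ltnS ?(leq_trans _ n4)// invr_gt0 e0.
have size_tail : (n.+1 - 5 = n - 4)%N by rewrite subSS.
have enQn : e n * Q <= n%:R.
  rewrite /Q mulr_sumr (@le_trans _ _ (\sum_(1 <= j < n.+1) 1))//.
    apply: ler_sum_indexn => j /andP[j1 jn].
    by rewrite ler_pdivrMr ?e0 ?j1// mul1r es.
  by rewrite big_const_nat subSS subn0 iter_addr addr0.
(* The right-hand side splits by (n - 2)^2 = 4 + (n - 4) n. The harmonic mean [n%:R / Q] is at least
   the smallest value [e n], which settles the part [4 / Q]. *)
suff tail : \sum_(5 <= j < n.+1) e j <= (n%:R - 4) * n%:R / Q.
  have : 4 * (e n / n%:R) <= 4 / Q.
    by rewrite ler_wpM2l// ler_pdivrMr// mulrC ler_pdivlMr.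
  have -> : (n%:R - 2) ^+ 2 / Q = 4 / Q + (n%:R - 4) * n%:R / Q.
    by rewrite -mulrDl; congr (_ / _); ring.
  lra.
have [n5|n5] := ltnP n 5.
  rewrite big_geq// divr_ge0 ?(ltW Q0)// mulr_ge0 ?(ltW n0)//; lra.
(* If [e 5] is at most the harmonic mean, so is every term of the tail; only the other case needs an
   idea. *)
have [e5|e5] := leP (e 5 * Q) n%:R.
  apply: (@le_trans _ _ (\sum_(5 <= j < n.+1) n%:R / Q)).
    apply: ler_sum_indexn => j /andP[j1 jn].
    by apply: (@le_trans _ _ (e 5)); [exact: es|rewrite ler_pdivlMr].
  by rewrite big_const_nat iter_addr addr0 size_tail -[_ *+ (n - 4)]mulr_natl natrB// mulrA.
have e50 : 0 < e 5 by rewrite e0.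
(* The convex function 1/u lies below its chord between [(e 5)^-1] and [(e n)^-1]. This bounds [e j]
   by an affine function of [(e j)^-1], whose sum is controlled by [Q]. *)
apply: (@le_trans _ _ (\sum_(5 <= j < n.+1) (e n + e 5 - e n * e 5 * (e j)^-1))).
  apply: ler_sum_indexn => j /andP[j1 jn].
  have ej0 : 0 < e j by rewrite e0// (leq_trans _ j1).
  rewrite -subr_ge0.
  have -> : e n + e 5 - e n * e 5 / e j - e j = (e j - e n) * (e 5 - e j) / e j.
    by field; rewrite gt_eqF.
  by rewrite divr_ge0 ?(ltW ej0)// mulr_ge0// subr_ge0 es// (leq_trans _ j1).
rewrite sumrB -mulr_sumr big_const_nat iter_addr addr0 size_tail -[_ *+ (n - 4)]mulr_natl natrB//.
have QE : Q = \sum_(1 <= j < 5) (e j)^-1 + \sum_(5 <= j < n.+1) (e j)^-1.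
  by rewrite /Q (big_cat_nat (n := 5)).
have Q4 : \sum_(1 <= j < 5) (e j)^-1 <= 4 / e 5.
  apply: (@le_trans _ _ (\sum_(1 <= j < 5) (e 5)^-1)).
    apply: ler_sum_indexn => j /andP[j1 jn].
    by rewrite lef_pV2 ?posrE ?e0 ?j1 ?(leq_trans (ltnW jn))// es// ltnW.
  by rewrite big_const_nat iter_addr addr0 mulr_natl.
rewrite ler_pdivlMr//.
have := QE; set Qt := \sum_(5 <= j < n.+1) _ => QE'.
have Qt' : Q - 4 / e 5 <= Qt by lra.
apply: (@le_trans _ _ (((n%:R - 4) * (e n + e 5) - e n * e 5 * (Q - 4 / e 5)) * Q)).
  by rewrite ler_wpM2r ?(ltW Q0)// lerD2l lerN2 ler_wpM2l// mulr_ge0// ltW.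
(* The difference factors: the first factor is at least 2 since [n%:R - 2 <= e n * Q], and the
   second is positive in the present case. *)
rewrite -subr_ge0.
have -> : (n%:R - 4) * n%:R - ((n%:R - 4) * (e n + e 5) - e n * e 5 * (Q - 4 / e 5)) * Q
   = (e n * Q - (n%:R - 4)) * (e 5 * Q - n%:R) by field; rewrite gt_eqF.
by rewrite mulr_ge0//; lra.
Qed.

Local Notation gauss01 := (normal_prob 0 1).

(** * One-dimensional normal distributions *)

Lemma measurable_affine (R : realType) (m s : R) :
  measurable_fun [set: R] (fun z : R => m + s * z).
Proof. by apply: measurable_funD => //; apply: measurable_funM. Qed.

(** By uniqueness of Lebesgue measure: the pushforward under the affine map, scaled by [s], gives
    half-open intervals their length. *)
Lemma lebesgue_measure_affine (R : realType) (m s : R) (s0 : 0 < s) (A : set R) :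
  measurable A ->
  (s%:E * lebesgue_measure ((fun z => m + s * z)%R @^-1` A) = lebesgue_measure A)%E.
Proof.
move=> mA; apply/esym.
pose f : measurableTypeR R -> measurableTypeR R := fun z => m + s * z.
have mf : measurable_fun setT f by exact: measurable_affine.
pose mf' := isMeasurableFun.Build _ _ _ _ _ mf.
pose F : {mfun measurableTypeR R >-> measurableTypeR R} := HB.pack f mf'.
rewrite (@lebesgue_measure_unique _
  (mscale (NngNum (ltW s0)) (pushforward lebesgue_measure F)) _ _ mA)//.
move=> _ [[a b]] _ <-.
have fE : f @^-1` `]a, b]%classic = `](a - m) / s, (b - m) / s]%classic.
  apply/seteqP; split=> z /=; rewrite !in_itv/= ltr_pdivrMr// ler_pdivlMr//.
    by rewrite /f => /andP[? ?]; apply/andP; split; lra.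
  by rewrite /f => /andP[? ?]; apply/andP; split; lra.
transitivity (s%:E * lebesgue_measure (f @^-1` `]a, b]%classic))%E; last by [].
rewrite fE !lebesgue_measure_itv/= !lte_fin ltr_pM2r ?invr_gt0// ltrD2r.
case: ifP => _; last by rewrite mule0.
by rewrite -!EFinB -EFinM; congr EFin; field; rewrite gt_eqF.
Qed.

Lemma ge0_integral_image_measure d1 d2 (X : measurableType d1) (Y : measurableType d2)
    (R : realType) (f : X -> Y) (mu : {measure set X -> \bar R})
    (nu : {measure set Y -> \bar R}) (F : Y -> \bar R) :
  measurable_fun setT f -> (forall A, measurable A -> nu A = mu (f @^-1` A)) ->
  measurable_fun setT F -> (forall y, 0 <= F y)%E ->
  (\int[nu]_y F y = \int[mu]_x F (f x))%E.
Proof.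
move=> mf numu mF F0.
have -> : (\int[mu]_x F (f x) = \int[mu]_(x in f @^-1` setT) (F \o f) x)%E.
  by rewrite preimage_setT.
rewrite -(ge0_integral_pushforward mf)//.
by apply: eq_measure_integral => A mA _; exact: numu.
Qed.

Lemma ge0_integral_affine (R : realType) (m s : R) (F : R -> \bar R) : 0 < s ->
  measurable_fun [set: R] F -> (forall y, 0 <= F y)%E ->
  (\int[lebesgue_measure]_y F y = s%:E * \int[lebesgue_measure]_z F (m + s * z)%R)%E.
Proof.
move=> s0 mF F0.
have mFf : measurable_fun [set: R] (fun z => F (m + s * z)).
  by apply: measurableT_comp mF _; exact: measurable_affine.
rewrite -(ge0_integral_mscale lebesgue_measure measurableT (NngNum (ltW s0)))//.
apply: (@ge0_integral_image_measure _ _ (measurableTypeR R) (measurableTypeR R)) => //.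
  exact: measurable_affine.
by move=> A mA; exact: (esym (lebesgue_measure_affine _ m s s0 A mA)).
Qed.

Lemma normal_pdf_affine (R : realType) (m s z : R) : 0 < s ->
  s * normal_pdf m s (m + s * z) = normal_pdf 0 1 z.
Proof.
move=> s0; rewrite !normal_pdfE ?oner_neq0 ?gt_eqF// /normal_fun mulrA; congr (_ * _).
  rewrite /normal_peak expr1n mul1r -mulrnAr sqrtrM ?sqr_ge0// sqrtr_sqr gtr0_norm//.
  by rewrite invfM mulrA divff ?mul1r// gt_eqF.
by congr expR; field; rewrite gt_eqF.
Qed.

Lemma normal_prob_affine (R : realType) (m s : R) (s0 : 0 < s) (A : set R) :
  measurable A ->
  normal_prob m s A = gauss01 ((fun z => m + s * z) @^-1` A).
Proof.
move=> mA.
have mfA : measurable ((fun z : R => m + s * z) @^-1` A).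
  by rewrite -[X in measurable X]setTI; exact: measurable_affine.
pose h := (fun x => (normal_pdf m s x)%:E) \_ A.
have h0 y : (0 <= h y)%E.
  by rewrite /h patchE; case: ifP => // _; rewrite lee_fin normal_pdf_ge0.
have mh : measurable_fun [set: R] h.
  have mpdf : measurable_fun A (fun x => (normal_pdf m s x)%:E).
    by apply/measurable_EFinP; apply: measurable_funTS; exact: measurable_normal_pdf.
  exact: (measurable_restrictT _ mA).1 mpdf.
rewrite /normal_prob integral_mkcond [RHS]integral_mkcond -/h.
rewrite (ge0_integral_affine _ m s)// -ge0_integralZl ?lee_fin ?(ltW s0)//=; last first.
  by apply: measurableT_comp mh _; exact: measurable_affine.
rewrite /h; apply: eq_integral => z _; rewrite !patchE.
have -> : (m + s * z \in A) = (z \in (fun z => m + s * z) @^-1` A).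
  by apply/idP/idP; rewrite !inE.
by case: ifP => _; rewrite ?mule0// -EFinM normal_pdf_affine.
Qed.

Lemma ge0_integral_normal_affine (R : realType) (m s : R) (F : R -> \bar R) : 0 < s ->
  measurable_fun [set: R] F -> (forall y, 0 <= F y)%E ->
  (\int[normal_prob m s]_y F y = \int[gauss01]_z F (m + s * z)%R)%E.
Proof.
move=> s0 mF F0.
apply: (@ge0_integral_image_measure _ _ (measurableTypeR R) (measurableTypeR R) R
  (fun z => m + s * z) gauss01 (normal_prob m s) F _ _ mF F0).
  exact: measurable_affine.
by move=> A mA; exact: (normal_prob_affine _ m s s0 A mA).
Qed.

(** For [v = 0] the map has slope 0 and its image law is the point mass at [m], so degenerate and
    proper normal laws share one formula. *)
Lemma gauss_int_std (R : realType) (m v : R) (F : R -> \bar R) : 0 <= v ->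
  measurable_fun [set: R] F -> (forall y, 0 <= F y)%E ->
  gauss_int m v F = (\int[gauss01]_z F (m + Num.sqrt v * z)%R)%E.
Proof.
move=> v0 mF F0; rewrite /gauss_int; case: eqVneq => [->|vn0].
  rewrite sqrtr0; under eq_integral do rewrite mul0r addr0.
  by rewrite integral_cst//= [X in (_ * X)%E]probability_setT mule1.
by apply: ge0_integral_normal_affine => //; rewrite sqrtr_gt0 lt_neqAle eq_sym vn0.
Qed.


(** * Integration against a density *)

Lemma ge0_integral_density d (T : measurableType d) (R : realType)
    (mu nu : {measure set T -> \bar R}) (f : T -> R) (h : T -> \bar R) :
  measurable_fun setT f -> (forall x, 0 <= f x) ->
  (forall A, measurable A -> nu A = (\int[mu]_(x in A) (f x)%:E)%E) ->
  measurable_fun setT h -> (forall x, 0 <= h x)%E ->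
  (\int[nu]_x h x = \int[mu]_x (h x * (f x)%:E))%E.
Proof.
move=> mf f0 nuE mh h0.
pose h_ := nnsfun_approx measurableT mh.
have step (g : {nnsfun T >-> R}) :
    (\int[nu]_x (g x)%:E = \int[mu]_x ((g x)%:E * (f x)%:E))%E.
  transitivity (\sum_(r \in range g) (r%:E * nu (g @^-1` [set r])))%E.
    under eq_integral do rewrite fimfunE -fsumEFin//.
    rewrite ge0_integral_fsum//; last 2 first.
    - by move=> y; exact/measurable_EFinP/measurable_funM.
    - by move=> y x _; rewrite nnfun_muleindic_ge0.
    apply: eq_fsbigr => r _.
    by rewrite integralZl_indic_nnsfun// integral_indic// setIT.
  transitivity (\sum_(r \in range g)
      \int[mu]_x ((r * \1_(g @^-1` [set r]) x)%:E * (f x)%:E))%E; last first.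
    rewrite -ge0_integral_fsum//.
    - apply: eq_integral => x _; rewrite -ge0_mule_fsuml; last first.
        by move=> r; rewrite nnfun_muleindic_ge0.
      by rewrite fsumEFin// -fimfunE.
    - move=> r; apply: emeasurable_funM; apply/measurable_EFinP => //.
      exact/measurable_funM.
    - by move=> r x _; rewrite mule_ge0 ?nnfun_muleindic_ge0// lee_fin.
  apply: eq_fsbigr => r /set_mem[x _ <-].
  under [RHS]eq_integral do rewrite EFinM -muleA.
  rewrite ge0_integralZl//.
  - rewrite nuE// integral_mkcond; congr (_ * _)%E; apply: eq_integral => y _.
    by rewrite patchE indicE; case: ifP => _; rewrite ?mul1e ?mul0e.
  - apply: emeasurable_funM; apply/measurable_EFinP => //.
  - by move=> y _; rewrite mule_ge0 ?lee_fin.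
  - by rewrite lee_fin.
transitivity (limn (fun n => \int[nu]_x (h_ n x)%:E)%E).
  rewrite -monotone_convergence//.
  - by apply: eq_integral => y _; apply/esym/cvg_lim => //; exact: cvg_nnsfun_approx.
  - by move=> n; exact/measurable_EFinP.
  - by move=> n y _; rewrite lee_fin.
  - by move=> y _ m n mn; rewrite lee_fin; exact/lefP/nd_nnsfun_approx.
rewrite (_ : (fun n => _) = (fun n => \int[mu]_x ((h_ n x)%:E * (f x)%:E))%E); last first.
  by apply/funext => n; exact: step.
rewrite -monotone_convergence//.
- apply: eq_integral => y _; apply/cvg_lim => //; apply: cvgeZr => //.
  exact: cvg_nnsfun_approx.
- by move=> n; apply: emeasurable_funM; exact/measurable_EFinP.
- by move=> n y _; rewrite mule_ge0 ?lee_fin.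
- move=> y _ m n mn; rewrite lee_wpmul2r ?lee_fin//.
  exact/lefP/nd_nnsfun_approx.
Qed.

Lemma integral_density d (T : measurableType d) (R : realType)
    (mu nu : {measure set T -> \bar R}) (f u : T -> R) :
  measurable_fun setT f -> (forall x, 0 <= f x) ->
  (forall A, measurable A -> nu A = (\int[mu]_(x in A) (f x)%:E)%E) ->
  measurable_fun setT u ->
  (\int[nu]_x (u x)%:E = \int[mu]_x (u x * f x)%:E)%E.
Proof.
move=> mf f0 nuE mu_.
have mEu : measurable_fun setT (EFin \o u) by exact/measurable_EFinP.
rewrite integralE [RHS]integralE; congr (_ - _)%E.
  rewrite (ge0_integral_density _ _ _ mu nu f _ mf f0 nuE)//; last exact: measurable_funepos.
  apply: eq_integral => x _; rewrite !funeposE /= -EFin_max -EFinM -EFin_max.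
  by rewrite maxr_pMl// mul0r.
rewrite (ge0_integral_density _ _ _ mu nu f _ mf f0 nuE)//; last exact: measurable_funeneg.
apply: eq_integral => x _; rewrite !funenegE /= -EFin_max -EFinM -EFin_max.
by rewrite maxr_pMl// mul0r mulNr.
Qed.

Lemma integrable_density d (T : measurableType d) (R : realType)
    (mu nu : {measure set T -> \bar R}) (f u : T -> R) :
  measurable_fun setT f -> (forall x, 0 <= f x) ->
  (forall A, measurable A -> nu A = (\int[mu]_(x in A) (f x)%:E)%E) ->
  measurable_fun setT u ->
  mu.-integrable setT (EFin \o (fun x => u x * f x)) ->
  nu.-integrable setT (EFin \o u).
Proof.
move=> mf f0 nuE mu_ /integrableP[_ uf]; apply/integrableP; split.
  exact/measurable_EFinP.
rewrite (_ : \int[nu]_x _ = \int[mu]_x `|(u x * f x)%:E|)%E//.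
rewrite (integral_density _ _ _ mu nu f _ mf f0 nuE); last exact: measurableT_comp.
by apply: eq_integral => x _ /=; rewrite normrM (ger0_norm (f0 x)).
Qed.

Section gauss01.
Context (R : realType).
Local Notation phi := (@normal_pdf R 0 1).
Local Notation psi := (@normal_pdf R 0 (Num.sqrt 2)).

Lemma normal_pdf01E (y : R) : phi y = normal_peak 1 * expR (- (y ^+ 2 / 2)).
Proof. by rewrite normal_pdfE ?oner_neq0// /normal_fun subr0 expr1n mulNr. Qed.

Lemma normal_pdf_sqrt2E (y : R) :
  psi y = normal_peak (Num.sqrt 2) * expR (- (y ^+ 2 / 4)).
Proof.
rewrite normal_pdfE ?gt_eqF ?sqrtr_gt0// /normal_fun subr0 sqr_sqrtr// mulNr.
by rewrite -mulrnA.
Qed.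

(** The normal density of variance 2 is the integrable majorant: its exponent is half as large, and
    [1 + y ^+ 2] is at most 4 times [expR (y ^+ 2 / 4)]. *)
Lemma normal_pdf01_bound : exists2 k : R, 0 <= k &
  forall y, (1 + y ^+ 2) * phi y <= k * psi y.
Proof.
have p2 : 0 < normal_peak (Num.sqrt 2 : R) by rewrite normal_peak_gt0// gt_eqF// sqrtr_gt0.
have p1 : 0 < normal_peak (1 : R) by rewrite normal_peak_gt0// oner_neq0.
exists (4 * (normal_peak 1 / normal_peak (Num.sqrt 2))).
  by rewrite mulr_ge0// divr_ge0// ltW.
move=> y; rewrite normal_pdf01E normal_pdf_sqrt2E.
have -> (e : R) : 4 * (normal_peak 1 / normal_peak (Num.sqrt 2)) *
    (normal_peak (Num.sqrt 2) * e) = normal_peak 1 * (4 * e).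
  by field; rewrite gt_eqF.
rewrite mulrCA ler_pM2l//.
have -> : y ^+ 2 / 2 = y ^+ 2 / 4 + y ^+ 2 / 4 by field.
rewrite opprD expRD mulrA ler_pM2r ?expR_gt0// expRN ler_pdivrMr ?expR_gt0//.
have := expR_ge1Dx (y ^+ 2 / 4); have := sqr_ge0 y; lra.
Qed.

(** Polynomial decay is enough to make the boundary terms in Stein's identity vanish. *)
Lemma normal_pdf_sqrt2_le (y : R) : psi y <= normal_peak (Num.sqrt 2) * (4 / (4 + y ^+ 2)).
Proof.
have p2 : 0 < normal_peak (Num.sqrt 2 : R) by rewrite normal_peak_gt0// gt_eqF// sqrtr_gt0.
rewrite normal_pdf_sqrt2E ler_pM2l// expRN -[leRHS]invrK lef_pV2 ?posrE ?expR_gt0//.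
  have := expR_ge1Dx (y ^+ 2 / 4); rewrite invf_div; have := sqr_ge0 y; lra.
by rewrite invr_gt0 divr_gt0// ltr_wpDr// sqr_ge0.
Qed.

Lemma is_derive_normal_pdf01 (y : R) : is_derive y 1 phi (- y * phi y).
Proof.
have -> : phi = (fun x => normal_peak 1 * expR (- (x ^+ 2 / 2))).
  by apply/funext => x; rewrite normal_pdf01E.
apply: is_derive_eq.
by rewrite /GRing.scale/=; field.
Qed.

End gauss01.

(** * Stein's identity for the standard normal law *)

Section stein01.
Context (R : realType).
Local Notation phi := (@normal_pdf R 0 1).
Local Notation psi := (@normal_pdf R 0 (Num.sqrt 2)).
Local Notation gauss01 := (normal_prob (0 : R) 1).

Lemma integrable_mul_normal_pdf01 (u : R -> R) (K : R) :
  measurable_fun [set: R] u -> (forall y, `|u y| <= K * (1 + y ^+ 2)) ->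
  lebesgue_measure.-integrable [set: R] (EFin \o (fun y => u y * phi y)).
Proof.
move=> mu uK.
have K0 : 0 <= K.
  by have := le_trans (normr_ge0 _) (uK 0); rewrite expr0n/= addr0 mulr1.
have [k k0 pk] := normal_pdf01_bound R.
apply: (le_integrable measurableT _ _
  (integrableZl measurableT (K * k) (integrable_normal_pdf 0 (Num.sqrt 2)))).
- apply/measurable_EFinP; apply: measurable_funM => //.
  exact: measurable_normal_pdf.
- move=> y _ /=; rewrite lee_fin normrM.
  rewrite (ger0_norm (normal_pdf_ge0 _ _ _)) [leRHS]ger0_norm; last first.
    by rewrite !mulr_ge0// normal_pdf_ge0.
  apply: (@le_trans _ _ (K * ((1 + y ^+ 2) * phi y))).
    by rewrite mulrA ler_wpM2r// normal_pdf_ge0.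
  by rewrite -mulrA ler_wpM2l.
Qed.

Lemma integrable_gauss01 (u : R -> R) (K : R) :
  measurable_fun [set: R] u -> (forall y, `|u y| <= K * (1 + y ^+ 2)) ->
  gauss01.-integrable [set: R] (EFin \o u).
Proof.
move=> mu uK.
apply: (integrable_density _ _ _ lebesgue_measure gauss01 phi) => //.
- exact: measurable_normal_pdf.
- by move=> x; exact: normal_pdf_ge0.
- exact: integrable_mul_normal_pdf01 uK.
Qed.

(** The fundamental theorem of calculus on growing symmetric intervals, followed by dominated
    convergence. *)
Lemma integral_derive_vanishing (G G' : R -> R) :
  (forall y : R, is_derive y 1 G (G' y)) -> continuous G' ->
  lebesgue_measure.-integrable [set: R] (EFin \o G') ->
  (fun n => G n.+1%:R - G (- n.+1%:R)) @ \oo --> (0 : R) ->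
  (\int[lebesgue_measure]_y (G' y)%:E = 0)%E.
Proof.
move=> dG cG' iG' G0.
have mG' : measurable_fun [set: R] (EFin \o G') by exact: measurable_int iG'.
pose I n := `[- n.+1%:R, n.+1%:R]%classic : set R.
pose f n := (EFin \o G') \_ (I n).
have fE n : (\int[lebesgue_measure]_y f n y = (G n.+1%:R - G (- n.+1%:R))%:E)%E.
  rewrite /f -integral_mkcond.
  have n0 : (0 : R) < n.+1%:R by [].
  rewrite (@continuous_FTC2 _ G' G) ?EFinB//.
  - lra.
  - exact: continuous_subspaceT.
  - split.
    + by move=> x _; case: (dG x).
    + apply: cvg_at_right_filter; apply: differentiable_continuous.
      by apply/derivable1_diffP; case: (dG (- n.+1%:R)).
    + apply: cvg_at_left_filter; apply: differentiable_continuous.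
      by apply/derivable1_diffP; case: (dG (n.+1%:R)).
  - by move=> x _; rewrite derive1E; case: (dG x).
have mf n : measurable_fun [set: R] (f n).
  apply: (measurable_restrictT _ _).1; first exact: measurable_itv.
  exact: measurable_funS mG'.
have cf : {ae lebesgue_measure, forall y : R, setT y -> f ^~ y @ \oo --> (EFin \o G') y}.
  apply: aeW => y _; apply: cvg_near_cst.
  near=> n; rewrite /f patchE mem_set//= /I /= in_itv/=.
  rewrite -ler_norml; apply: (@le_trans _ _ n%:R); last by rewrite ler_nat.
  by near: n; exact: nbhs_infty_ger.
have df : {ae lebesgue_measure, forall (y : R) n, setT y ->
    (`|f n y| <= (abse \o (EFin \o G')) y)%E}.
  by apply: aeW => y n _; rewrite /f patchE; case: ifP => _ /=; rewrite ?normr0 lee_fin.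
have [_ _] := @dominated_convergence _ (measurableTypeR R) _ lebesgue_measure _ measurableT
  _ _ _ mf mG' cf (integrable_abse iG') df.
rewrite (_ : (fun n => _) = EFin \o (fun n => G n.+1%:R - G (- n.+1%:R))); last first.
  by apply/funext => n; rewrite fE.
move=> cI; apply/esym; apply: (@cvg_unique _ _ _ _ _ _ _ cI) => //.
by apply/fine_cvgP; split; first exact: nearW.
Unshelve. all: by end_near. Qed.

(** Since the standard normal density satisfies [phi' = - y * phi], the difference of the two
    integrands is the derivative of [h * phi], which vanishes at infinity. *)
Lemma stein01 (h h' : R -> R) (C : R) :
  (forall y : R, is_derive y 1 h (h' y)) -> continuous h' ->
  (forall y, `|h y| <= C * (1 + `|y|)) -> (forall y, `|h' y| <= C) ->
  (\int[gauss01]_y (y * h y)%:E = \int[gauss01]_y (h' y)%:E)%E.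
Proof.
move=> dh ch' hC h'C.
have C0 : 0 <= C by exact: le_trans (normr_ge0 _) (h'C 0).
have ch : continuous h.
  by move=> y; apply: differentiable_continuous; apply/derivable1_diffP; case: (dh y).
have mh : measurable_fun [set: R] h by exact: continuous_measurable_fun.
have mh' : measurable_fun [set: R] h' by exact: continuous_measurable_fun.
have absy y : `|y| <= 1 + y ^+ 2 :> R.
  rewrite -real_normK ?num_real//; have := sqr_ge0 (`|y| - 1); have := sqr_ge0 `|y|; lra.
have yhC y : `|y * h y| <= 2 * C * (1 + y ^+ 2).
  rewrite normrM; apply: (@le_trans _ _ (`|y| * (C * (1 + `|y|)))).
    by rewrite ler_wpM2l.
  have -> : `|y| * (C * (1 + `|y|)) = C * (`|y| + `|y| ^+ 2) by ring.
  rewrite real_normK ?num_real// (mulrC 2) -mulrA ler_wpM2l//.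
  have := absy y; have := sqr_ge0 y; lra.
have h'C2 y : `|h' y| <= C * (1 + y ^+ 2).
  by apply: le_trans (h'C y) _; rewrite ler_peMr// lerDl sqr_ge0.
have mphi : measurable_fun [set: R] phi by exact: measurable_normal_pdf.
have phi0 y : 0 <= phi y by exact: normal_pdf_ge0.
rewrite !(integral_density _ _ _ lebesgue_measure gauss01 phi)//; last first.
  exact: measurable_funM.
have i1 : lebesgue_measure.-integrable [set: R] (EFin \o (fun y => y * h y * phi y)).
  by apply: integrable_mul_normal_pdf01 yhC; exact: measurable_funM.
have i2 : lebesgue_measure.-integrable [set: R] (EFin \o (fun y => h' y * phi y)).
  exact: integrable_mul_normal_pdf01 h'C2.
have i21 := integrableB measurableT i2 i1.
have cphi : continuous phi by apply: continuous_normal_pdf; rewrite oner_neq0.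
suff : (\int[lebesgue_measure]_y (h' y * phi y - y * h y * phi y)%:E = 0)%E.
  have -> := integralB measurableT i2 i1.
  move/eqP; rewrite sube_eq ?add0e; last 2 first.
  - exact: integrable_fin_num.
  - by rewrite fin_num_adde_defr// integrable_fin_num.
  by move/eqP.
apply: (@integral_derive_vanishing (fun y => h y * phi y)).
- move=> y; have dphi := is_derive_normal_pdf01 R y; have dhy := dh y.
  by apply: is_derive_eq; rewrite /GRing.scale/=; ring.
- move=> y; apply: cvgB; apply: cvgM; [exact: ch'|exact: cphi| |exact: cphi].
  by apply: cvgM; [exact: cvg_id|exact: ch].
- exact: i21.
- have [k k0 pk] := normal_pdf01_bound R.
  pose K := 2 * C * k * normal_peak (Num.sqrt 2 : R) * 4.
  (* Stated through [y ^+ 2] to serve both endpoints [n.+1] and [- n.+1]. *)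
  have hphi (n : nat) (y : R) : y ^+ 2 = n.+1%:R ^+ 2 -> `|h y * phi y| <= K * n.+1%:R^-1.
    move=> yn; rewrite normrM (ger0_norm (phi0 _)).
    apply: (@le_trans _ _ (2 * C * ((1 + y ^+ 2) * phi y))).
      rewrite mulrA ler_wpM2r//; apply: le_trans (hC y) _.
      rewrite (mulrC 2) -mulrA ler_wpM2l//; have := absy y; have := sqr_ge0 y; lra.
    apply: (@le_trans _ _ (2 * C * (k * psi y))).
      by rewrite ler_wpM2l// mulr_ge0.
    rewrite /K -!mulrA ler_wpM2l// ler_wpM2l// ler_wpM2l//.
    apply: le_trans (normal_pdf_sqrt2_le _ _) _.
    rewrite ler_wpM2l ?normal_peak_ge0// ler_wpM2l// lef_pV2 ?posrE//; last first.
      by rewrite ltr_wpDr// sqr_ge0.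
    rewrite yn; have := sqr_ge0 (n.+1%:R - 1 : R); have := ler0n R n.+1; lra.
  clearbody K.
  apply: (@squeeze_cvgr _ _ _ _ (fun n => - (2 * K * n.+1%:R^-1)) (fun n => 2 * K * n.+1%:R^-1)).
  + near=> n; have := hphi n n.+1%:R erefl.
    have := hphi n (- n.+1%:R) (sqrrN _); rewrite /=.
    move: (n.+1%:R : R) => m; move: (h m * _) (h (- m) * _) => u v.
    rewrite !ler_norml -mulrA => /andP[? ?] /andP[? ?]; apply/andP; split; lra.
  + rewrite -oppr0; apply: cvgN; rewrite -(mulr0 (2 * K)); apply: cvgM; first exact: cvg_cst.
    exact: cvg_harmonic.
  + rewrite -(mulr0 (2 * K)); apply: cvgM; first exact: cvg_cst.
    exact: cvg_harmonic.
Unshelve. all: by end_near. Qed.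

End stein01.

(** * Standard normal vectors *)

Set Implicit Arguments.
Unset Strict Implicit.

(* Measurability along every measurable family of points, so that no
   sigma-algebra on [nat -> R] has to be fixed. *)
Definition coord_measurable (R : realType) d' (Y : measurableType d')
    (F : (nat -> R) -> Y) : Prop :=
  forall d (T : measurableType d) (phi : T -> nat -> R),
    (forall i, measurable_fun setT (fun t => phi t i)) ->
    measurable_fun setT (fun t => F (phi t)).

(** Coordinates outside [1..n] are 0, the value that [gauss_vec_int] leaves there. *)
Definition affine_coord (R : realType) (n : nat) (mu v z : nat -> R) : nat -> R :=
  fun j => if (1 <= j <= n)%N then mu j + Num.sqrt (v j) * z j else 0.

(** All that is used of [n] independent standard normal coordinates. Independence is not stated as
    such: it is contained in the formula for the iterated integrals and in the Stein identity for
    functions of the whole vector. *)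
Definition std_normal_vector (R : realType) (n : nat) d (T : measurableType d)
    (P : probability T R) (Z : T -> nat -> R) : Prop :=
  [/\ forall i, measurable_fun setT (fun t => Z t i),
      forall mu v F, (forall j, (1 <= j <= n)%N -> 0 <= v j) ->
        coord_measurable F -> (forall x, 0 <= F x)%E ->
        (gauss_vec_int n mu v F = \int[P]_t F (affine_coord n mu v (Z t)))%E,
      forall j, (1 <= j <= n)%N -> P.-integrable setT (fun t => (Z t j ^+ 2)%:E)
    & forall j (f f' : (nat -> R) -> R) (C : R), (1 <= j <= n)%N ->
        coord_measurable f -> coord_measurable f' ->
        (forall x, `|f x| <= C * (1 + `|x j|)) -> (forall x, `|f' x| <= C) ->
        (forall x (y : R), is_derive y 1 (fun y => f (vset x j y)) (f' (vset x j y))) ->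
        (forall x, continuous (fun y => f' (vset x j y))) ->
        (\int[P]_t (Z t j * f (Z t))%:E = \int[P]_t (f' (Z t))%:E)%E].

Lemma measurable_vset (R : realType) d (T : measurableType d) (phi : T -> nat -> R)
    (j : nat) (y : T -> R) :
  (forall i, measurable_fun setT (fun t => phi t i)) -> measurable_fun setT y ->
  forall i, measurable_fun setT (fun t => vset (phi t) j (y t) i).
Proof. by move=> mphi my i; rewrite /vset; case: eqP. Qed.

Lemma measurable_affine_coord (R : realType) d (T : measurableType d)
    (n : nat) (mu : T -> nat -> R) (v : nat -> R) (z : T -> nat -> R) :
  (forall i, measurable_fun setT (fun t => mu t i)) ->
  (forall i, measurable_fun setT (fun t => z t i)) ->
  forall i, measurable_fun setT (fun t => affine_coord n (mu t) v (z t) i).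
Proof.
move=> mmu mz i; rewrite /affine_coord; case: (1 <= i <= n)%N => //.
apply: measurable_funD; first exact: mmu.
exact: (measurable_funM (measurable_cst (Num.sqrt (v i))) (mz i)).
Qed.

Lemma coord_measurable_vset (R : realType) d' (Y : measurableType d')
    (F : (nat -> R) -> Y) j (y : R) :
  coord_measurable F -> coord_measurable (fun x => F (vset x j y)).
Proof. by move=> mF d T phi mphi; apply: mF; apply: measurable_vset. Qed.

Section product_integrability.
Context (R : realType) d1 d2 (S : measurableType d1) (T : measurableType d2)
  (Q : probability S R) (P : probability T R).

Lemma integrable_comp_snd (u : T -> R) : P.-integrable setT (EFin \o u) ->
  (Q \x P)%E.-integrable setT (fun w => (u w.2)%:E).
Proof.
move=> iu; have mu : measurable_fun setT (EFin \o u) by exact: measurable_int iu.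
apply/integrable12ltyP; first exact: measurableT_comp mu measurable_snd.
rewrite /= integral_cst//=. rewrite [X in (_ * X)%E]probability_setT mule1.
by have /integrableP[] := iu.
Qed.

Lemma integrable_comp_fst (u : S -> R) : Q.-integrable setT (EFin \o u) ->
  (Q \x P)%E.-integrable setT (fun w => (u w.1)%:E).
Proof.
move=> iu; have mu : measurable_fun setT (EFin \o u) by exact: measurable_int iu.
apply/integrable21ltyP; first exact: measurableT_comp mu measurable_fst.
rewrite /= integral_cst//=. rewrite [X in (_ * X)%E]probability_setT mule1.
by have /integrableP[] := iu.
Qed.

End product_integrability.

Lemma integrable_le_sqr (R : realType) d (T : measurableType d) (P : probability T R)
    (z u : T -> R) (C : R) :
  measurable_fun setT u -> P.-integrable setT (fun t => (z t ^+ 2)%:E) ->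
  (forall t, `|u t| <= C * (1 + z t ^+ 2)) -> P.-integrable setT (EFin \o u).
Proof.
move=> mu iz uC.
have i1 : P.-integrable setT (EFin \o cst 1) by exact: finite_measure_integrable_cst.
have := integrableZl measurableT C (integrableD measurableT i1 iz).
apply: le_integrable => //; first exact/measurable_EFinP.
by move=> t _ /=; rewrite lee_fin (le_trans (uC t))// ler_norm.
Qed.

Lemma normrM_le_sqr (R : realFieldType) (C z u : R) : `|u| <= C * (1 + `|z|) ->
  `|z * u| <= 2 * C * (1 + z ^+ 2).
Proof.
move=> uC; rewrite normrM -(real_normK (num_real z)).
have C0 : 0 <= C.
  by have := le_trans (normr_ge0 _) uC; rewrite pmulr_lge0// ltr_pwDl.
apply: (@le_trans _ _ (`|z| * (C * (1 + `|z|)))); first by rewrite ler_wpM2l.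
have -> : `|z| * (C * (1 + `|z|)) = C * (`|z| + `|z| ^+ 2) by ring.
rewrite (mulrC 2) -mulrA ler_wpM2l//.
have := sqr_ge0 (`|z| - 1); have := sqr_ge0 `|z|; lra.
Qed.

Lemma integrable_bounded (R : realType) d (X : measurableType d) (M : probability X R) (u : X -> R) (C : R) :
  measurable_fun setT u -> (forall t, `|u t| <= C) -> M.-integrable setT (EFin \o u).
Proof.
move=> mu uC; have i1 := finite_measure_integrable_cst M C measurableT.
apply: le_integrable i1 => //; first exact/measurable_EFinP.
by move=> t _ /=; rewrite lee_fin (le_trans (uC t))// ler_norm.
Qed.

Section stein_product.
Context (R : realType) d1 d2 (S : measurableType d1) (T : measurableType d2)
  (Q : probability S R) (P : probability T R).

(** Fubini: the identity holds for each fixed value of the other factor, and the growth bounds make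
    both sides integrable on the product. *)
Lemma stein_product_snd (z : T -> R) (f f' : S * T -> R) (C : R) :
  measurable_fun setT z -> P.-integrable setT (fun t => (z t ^+ 2)%:E) ->
  measurable_fun setT f -> measurable_fun setT f' ->
  (forall w, `|f w| <= C * (1 + `|z w.2|)) -> (forall w, `|f' w| <= C) ->
  (forall s, \int[P]_t (z t * f (s, t))%:E = \int[P]_t (f' (s, t))%:E)%E ->
  (\int[Q \x P]_w (z w.2 * f w)%:E = \int[Q \x P]_w (f' w)%:E)%E.
Proof.
move=> mz iz mf mf' fC f'C H.
have mz2 : measurable_fun setT (fun w : S * T => z w.2) by exact: measurableT_comp.
have i1 : (Q \x P)%E.-integrable setT (EFin \o (fun w => z w.2 * f w)).
  apply: (@integrable_le_sqr _ _ _ _ (fun w => z w.2) _ (2 * C)).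
  - exact: measurable_funM.
  - exact: (integrable_comp_snd Q (u := fun t => z t ^+ 2)).
  - by move=> w; exact: normrM_le_sqr.
have i2 : (Q \x P)%E.-integrable setT (EFin \o f') by exact: integrable_bounded f'C.
rewrite -(integral12_prod_meas1 i1) -(integral12_prod_meas1 i2).
by apply: eq_integral => s _; exact: H.
Qed.

Lemma stein_product_fst (z : S -> R) (f f' : S * T -> R) (C : R) :
  measurable_fun setT z -> Q.-integrable setT (fun s => (z s ^+ 2)%:E) ->
  measurable_fun setT f -> measurable_fun setT f' ->
  (forall w, `|f w| <= C * (1 + `|z w.1|)) -> (forall w, `|f' w| <= C) ->
  (forall t, \int[Q]_s (z s * f (s, t))%:E = \int[Q]_s (f' (s, t))%:E)%E ->
  (\int[Q \x P]_w (z w.1 * f w)%:E = \int[Q \x P]_w (f' w)%:E)%E.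
Proof.
move=> mz iz mf mf' fC f'C H.
have mz1 : measurable_fun setT (fun w : S * T => z w.1) by exact: measurableT_comp.
have i1 : (Q \x P)%E.-integrable setT (EFin \o (fun w => z w.1 * f w)).
  apply: (@integrable_le_sqr _ _ _ _ (fun w => z w.1) _ (2 * C)).
  - exact: measurable_funM.
  - exact: (integrable_comp_fst P (u := fun t => z t ^+ 2)).
  - by move=> w; exact: normrM_le_sqr.
have i2 : (Q \x P)%E.-integrable setT (EFin \o f') by exact: integrable_bounded f'C.
rewrite -(integral21_prod_meas1 i1) -(integral21_prod_meas1 i2).
by apply: eq_integral => t _; exact: H.
Qed.

End stein_product.

Lemma vset_comm (R : realType) (x : nat -> R) i j (y z : R) : i != j ->
  vset (vset x i y) j z = vset (vset x j z) i y.
Proof.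
move=> ij; apply/funext => k; rewrite /vset.
by case: (eqVneq k j) => [->|//]; rewrite eq_sym (negbTE ij).
Qed.

Lemma vset_affine_coord (R : realType) n (mu v z : nat -> R) (y : R) :
  vset (affine_coord n mu v z) n.+1 (mu n.+1 + Num.sqrt (v n.+1) * y) =
  affine_coord n.+1 mu v (vset z n.+1 y).
Proof.
apply/funext => j; rewrite /affine_coord /vset.
case: eqVneq => [->|jn]; first by rewrite leqnn.
by rewrite [(j <= n.+1)%N]leq_eqVlt (negbTE jn) ltnS.
Qed.

(** The new coordinate is the first factor, because [gauss_vec_int] integrates over coordinate
    [n.+1] outermost. *)
Lemma std_normal_vectorS (R : realType) n d (T : measurableType d) (P : probability T R)
    (Z : T -> nat -> R) : std_normal_vector n P Z ->
  std_normal_vector n.+1 (normal_prob (0 : R) 1 \x P)%E (fun w => vset (Z w.2) n.+1 w.1).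
Proof.
case=> mZ ZE iZ steinZ; set N := normal_prob _ _.
have mZ2 i : measurable_fun setT (fun w : measurableTypeR R * T => Z w.2 i).
  by apply: (measurableT_comp (mZ i)); exact: measurable_snd.
have m1 : measurable_fun setT (fun w : measurableTypeR R * T => w.1) by exact: measurable_fst.
have mid : measurable_fun [set: measurableTypeR R] (fun y : R => y) by exact: measurable_id.
have mZ' i : measurable_fun setT (fun w : measurableTypeR R * T => vset (Z w.2) n.+1 w.1 i).
  exact: measurable_vset.
have iN : N.-integrable [set: R] (fun y => (y ^+ 2)%:E).
  apply: (@integrable_gauss01 R (fun y => y ^+ 2) 1).
    exact: measurable_funX.
  by move=> y; rewrite mul1r ger0_norm ?sqr_ge0// lerDr.
split=> //.
- move=> mu v F v0 mF F0 /=.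
  have v0' j : (1 <= j <= n)%N -> 0 <= v j.
    by move=> /andP[j1 jn]; rewrite v0// j1 leqW.
  rewrite [X in gauss_int _ _ X](_ : _ =
      fun y => (\int[P]_t F (vset (affine_coord n mu v (Z t)) n.+1 y))%E); last first.
    by apply/funext => y; rewrite ZE//; exact: coord_measurable_vset.
  have mG : measurable_fun setT (fun w : measurableTypeR R * T =>
      F (vset (affine_coord n mu v (Z w.2)) n.+1 w.1)).
    by apply: mF; apply: measurable_vset => //; exact: measurable_affine_coord.
  rewrite gauss_int_std//.
  + have mH : measurable_fun setT (fun w : measurableTypeR R * T =>
        F (affine_coord n.+1 mu v (vset (Z w.2) n.+1 w.1))).
      by apply: mF; exact: measurable_affine_coord.
    rewrite (fubini_tonelli1 _ mH); last by move=> w; exact: F0.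
    by apply: eq_integral => y _; apply: eq_integral => t _; rewrite vset_affine_coord.
  + by apply: v0; rewrite leqnn.
  + exact: (measurable_fun_fubini_tonelli_F _ mG).
  + by move=> y; exact: integral_ge0.
- move=> j /andP[j1]; rewrite leq_eqVlt => /predU1P[->|jn].
    rewrite (_ : (fun _ => _) = (fun w => (w.1 ^+ 2)%:E)); last first.
      by apply/funext => w; rewrite /vset eqxx.
    exact: (integrable_comp_fst P (Q := N) (u := fun y => y ^+ 2)).
  rewrite (_ : (fun _ => _) = (fun w => (Z w.2 j ^+ 2)%:E)); last first.
    by apply/funext => w; rewrite /vset (ltn_eqF jn).
  by apply: (integrable_comp_snd N (u := fun t => Z t j ^+ 2)); apply: iZ; rewrite j1.
- move=> j f f' C /andP[j1]; rewrite leq_eqVlt => /predU1P[->|jn] mf mf' fC f'C df cf'.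
    under eq_integral do rewrite {1}/vset eqxx.
    apply: (@stein_product_fst _ _ _ _ _ N P (fun y : R => y) _ _ C) => //.
    + exact: mf.
    + exact: mf'.
    + by move=> w; apply: le_trans (fC _) _; rewrite /vset eqxx.
    + move=> t /=; apply: (@stein01 R _ _ C) => // y.
      by apply: le_trans (fC _) _; rewrite /vset eqxx.
  under eq_integral do rewrite {1}/vset (ltn_eqF jn).
  apply: (@stein_product_snd _ _ _ _ _ N P (fun t => Z t j) _ _ C) => //.
  + by apply: iZ; rewrite j1.
  + exact: mf.
  + exact: mf'.
  + by move=> w; apply: le_trans (fC _) _; rewrite /vset (ltn_eqF jn).
  + move=> y /=.
    apply: (steinZ j (fun x => f (vset x n.+1 y)) (fun x => f' (vset x n.+1 y)) C).
    * by rewrite j1.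
    * exact: coord_measurable_vset.
    * exact: coord_measurable_vset.
    * by move=> x; apply: le_trans (fC _) _; rewrite /vset (ltn_eqF jn).
    * by move=> x.
    * move=> x u; rewrite (_ : (fun y0 => _) = (fun y0 => f (vset (vset x n.+1 y) j y0))).
        by rewrite vset_comm ?(ltn_eqF jn).
      by apply/funext => y0; rewrite vset_comm ?(ltn_eqF jn).
    * move=> x; rewrite (_ : (fun y0 => _) = (fun y0 => f' (vset (vset x n.+1 y) j y0)))//.
      by apply/funext => y0; rewrite vset_comm ?(ltn_eqF jn).
Qed.

Lemma std_normal_vector_exists (R : realType) (n : nat) :
  exists d (T : measurableType d) (P : probability T R) (Z : T -> nat -> R),
    std_normal_vector n P Z.
Proof.
elim: n => [|n [d [T [P [Z PZ]]]]]; last first.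
  do 4 eexists; exact: std_normal_vectorS PZ.
(* For [n = 0] any probability space serves; the vector is constantly 0. *)
exists _, (measurableTypeR R), (normal_prob (0 : R) 1), (fun _ _ => 0); split=> //.
- move=> mu v F _ mF F0 /=.
  rewrite (_ : (fun t => _) = cst (F (fun=> 0))); last first.
    by apply/funext => t; congr F; apply/funext => j; rewrite /affine_coord; case: j.
  by rewrite integral_cst//= [X in (_ * X)%E]probability_setT mule1.
- by case.
- by case.
Qed.

(** * The joint model of parameter and noise *)

Lemma affine_coord_vset (R : realType) p (b v z : nat -> R) j y : (1 <= j <= p)%N ->
  (fun i => b i + affine_coord p (fun=> 0) v (vset z j y) i) =
  vset (fun i => b i + affine_coord p (fun=> 0) v z i) j (b j + Num.sqrt (v j) * y).
Proof.
move=> jp; apply/funext => i; rewrite /affine_coord /vset.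
by case: (eqVneq i j) => [->|//]; rewrite jp add0r.
Qed.

Lemma coord_measurable_shift (R : realType) d' (Y : measurableType d')
    (F : (nat -> R) -> Y) p (b v : nat -> R) :
  coord_measurable F ->
  coord_measurable (fun z => F (fun i => b i + affine_coord p (fun=> 0) v z i)).
Proof.
move=> mF d T phi mphi; apply: mF => i.
by apply: measurable_funD => //; exact: measurable_affine_coord.
Qed.

Lemma is_derive_comp_affine (R : realType) (f : R -> R) (m s y df : R) :
  is_derive (m + s * y) 1 f df -> is_derive y 1 (fun y => f (m + s * y)) (s * df).
Proof.
move=> dF.
have dA : is_derive y 1 (fun y : R => m + s * y) s.
  by apply: is_derive_eq; rewrite /GRing.scale/=; ring.
have := @is_derive1_comp _ f (fun y : R => m + s * y) y df s dF dA.
by rewrite mulrC.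
Qed.

(** The shift [b] is the other summand of the observation held fixed: the parameter when the noise
    is integrated, and conversely. The chain rule contributes [Num.sqrt (v j)]. *)
Lemma stein_shift (R : realType) p dT (T : measurableType dT) (P : probability T R)
    (Z : T -> nat -> R) (b v : nat -> R) j (f f' : (nat -> R) -> R) (C : R) :
  std_normal_vector p P Z -> (1 <= j <= p)%N ->
  coord_measurable f -> coord_measurable f' ->
  (forall x, `|f x| <= C) -> (forall x, `|f' x| <= C) ->
  (forall x (y : R), is_derive y 1 (fun y => f (vset x j y)) (f' (vset x j y))) ->
  (forall x, continuous (fun y => f' (vset x j y))) ->
  let X t i := b i + affine_coord p (fun=> 0) v (Z t) i in
  (\int[P]_t (Z t j * f (X t))%:E = \int[P]_t (Num.sqrt (v j) * f' (X t))%:E)%E.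
Proof.
move=> [_ _ _ steinZ] jp mf mf' fC f'C df cf' X.
have C0 : 0 <= C by exact: le_trans (normr_ge0 _) (fC (fun=> 0)).
have s0 := sqrtr_ge0 (v j).
apply: (steinZ j (fun z => f (fun i => b i + affine_coord p (fun=> 0) v z i))
  (fun z => Num.sqrt (v j) * f' (fun i => b i + affine_coord p (fun=> 0) v z i))
  (C * (1 + Num.sqrt (v j)))) => //.
- exact: coord_measurable_shift.
- move=> d' T' phi mphi.
  apply: (measurable_funM (measurable_cst (Num.sqrt (v j)))).
  exact: (coord_measurable_shift p b v mf' mphi).
- move=> x; apply: le_trans (fC _) _; rewrite -mulrA ler_peMr//.
  by rewrite -[leLHS]mulr1 ler_pM// lerDl.
- move=> x; rewrite normrM (ger0_norm s0) mulrC ler_pM//.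
  by rewrite lerDr.
- move=> x y; rewrite affine_coord_vset//.
  rewrite (_ : (fun y0 => _) = (fun y0 => f (vset (fun i => b i + affine_coord p (fun=> 0) v x i) j
     (b j + Num.sqrt (v j) * y0)))); last first.
    by apply/funext => y0; rewrite affine_coord_vset.
  exact: (is_derive_comp_affine (df _ _)).
- move=> x; rewrite (_ : (fun y0 => _) = (fun y0 => Num.sqrt (v j) *
     f' (vset (fun i => b i + affine_coord p (fun=> 0) v x i) j (b j + Num.sqrt (v j) * y0)))); last first.
    by apply/funext => y0; rewrite affine_coord_vset.
  move=> y; apply: cvgM; first exact: cvg_cst.
  apply: (@continuous_comp _ _ _ (fun y0 : R => b j + Num.sqrt (v j) * y0)
     (fun u : R => f' (vset (fun i => b i + affine_coord p (fun=> 0) v x i) j u))).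
    by apply: cvgD; [exact: cvg_cst|apply: cvgM; [exact: cvg_cst|exact: cvg_id]].
  exact: cf'.
Qed.

(** [th] is the parameter and [U] the noise, so that the observation is their sum. The last clause
    has one Stein identity for each of them, with test functions of the observation only. *)
Definition bayes_model (R : realType) (p : nat) (d g : nat -> R) dO
    (Omega : measurableType dO) (P : probability Omega R) (th U : Omega -> nat -> R) : Prop :=
  let X w i := th w i + U w i in
  [/\ (forall i, measurable_fun setT (fun w => th w i)) /\
      (forall i, measurable_fun setT (fun w => U w i)),
      forall est, (forall j, coord_measurable (fun x => est x j)) ->
        (bayes_risk p d g est =
         \int[P]_w (\sum_(1 <= j < p.+1) (est (X w) j - th w j) ^+ 2)%:E)%E,
      forall j, (1 <= j <= p)%N ->
        P.-integrable setT (fun w => (th w j ^+ 2)%:E) /\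
        P.-integrable setT (fun w => (U w j ^+ 2)%:E),
      forall j, (1 <= j <= p)%N -> (\int[P]_w (U w j ^+ 2)%:E = (d j)%:E)%E
    & forall j (f f' : (nat -> R) -> R) (C : R), (1 <= j <= p)%N ->
        coord_measurable f -> coord_measurable f' ->
        (forall x, `|f x| <= C) -> (forall x, `|f' x| <= C) ->
        (forall x (y : R), is_derive y 1 (fun y => f (vset x j y)) (f' (vset x j y))) ->
        (forall x, continuous (fun y => f' (vset x j y))) ->
        (\int[P]_w (U w j * f (X w))%:E = (d j)%:E * \int[P]_w (f' (X w))%:E)%E /\
        (\int[P]_w (th w j * f (X w))%:E = (g j)%:E * \int[P]_w (f' (X w))%:E)%E].

Lemma bayes_model_exists (R : realType) (p : nat) (d g : nat -> R) :
  (forall j, (1 <= j <= p)%N -> 0 <= d j) ->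
  (forall j, (1 <= j <= p)%N -> 0 <= g j) ->
  exists dO (Omega : measurableType dO) (P : probability Omega R) (th U : Omega -> nat -> R),
    bayes_model p d g P th U.
Proof.
move=> d0 g0; have [dT [T [P [Z PZ]]]] := std_normal_vector_exists R p.
have [mZ ZE iZ steinZ] := PZ.
pose th (w : T * T) := affine_coord p (fun=> 0) g (Z w.1).
pose U (w : T * T) := affine_coord p (fun=> 0) d (Z w.2).
have mZ1 i : measurable_fun setT (fun w : T * T => Z w.1 i).
  by apply: (measurableT_comp (mZ i)); exact: measurable_fst.
have mZ2 i : measurable_fun setT (fun w : T * T => Z w.2 i).
  by apply: (measurableT_comp (mZ i)); exact: measurable_snd.
have mth i : measurable_fun setT (fun w => th w i) by exact: measurable_affine_coord.
have mU i : measurable_fun setT (fun w => U w i) by exact: measurable_affine_coord.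
have mX i : measurable_fun setT (fun w => th w i + U w i) by exact: measurable_funD.
pose X w i := th w i + U w i.
have thE j w : (1 <= j <= p)%N -> th w j = Num.sqrt (g j) * Z w.1 j.
  by move=> jp; rewrite /th /affine_coord jp add0r.
have UE j w : (1 <= j <= p)%N -> U w j = Num.sqrt (d j) * Z w.2 j.
  by move=> jp; rewrite /U /affine_coord jp add0r.
(* The second moment is Stein's identity applied to the coordinate function itself. *)
have Z1 j : (1 <= j <= p)%N -> (\int[P]_t (Z t j ^+ 2)%:E = 1)%E.
  move=> jp; have H : (\int[P]_t (Z t j * Z t j)%:E = \int[P]_t 1%:E)%E.
    apply: (steinZ j (fun x => x j) (fun=> 1) 1) => //.
    - by move=> x; rewrite mul1r lerDr.
    - by move=> x; rewrite normr1.
    - move=> x y; rewrite (_ : (fun y0 => _) = id); first exact: is_derive_id.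
      by apply/funext => y0; rewrite /vset eqxx.
    - by move=> x y; exact: cvg_cst.
  under eq_integral do rewrite expr2.
  by rewrite H integral_cst//= [X in (_ * X)%E]probability_setT mule1.
exists _, _, (P \x P)%E, th, U; split.
- by split.
- move=> est mest; rewrite /bayes_risk.
  have mF dS (S : measurableType dS) (phi psi : S -> nat -> R) :
      (forall i, measurable_fun setT (fun t => phi t i)) ->
      (forall i, measurable_fun setT (fun t => psi t i)) ->
      measurable_fun setT (fun s => (\sum_(1 <= j < p.+1) (est (psi s) j - phi s j) ^+ 2)%:E).
    move=> mphi mpsi; apply/measurable_EFinP; apply: measurable_sum => j.
    by apply: measurable_funX; apply: measurable_funB => //; exact: mest.
  have F0 (th0 x : nat -> R) : (0 <= (\sum_(1 <= j < p.+1) (est x j - th0 j) ^+ 2)%:E)%E.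
    by rewrite lee_fin sumr_ge0// => j _; exact: sqr_ge0.
  rewrite [X in gauss_vec_int _ _ _ X](_ : _ = fun th0 =>
     (\int[P]_t (\sum_(1 <= j < p.+1) (est (affine_coord p th0 d (Z t)) j - th0 j) ^+ 2)%:E)%E); last first.
    apply/funext => th0; rewrite ZE//.
    by move=> dS S phi mphi; apply: mF.
  rewrite ZE//; last 2 first.
  + move=> dS S phi mphi.
    apply: (measurable_fun_fubini_tonelli_F (m2 := P) (fun w : S * T =>
      (\sum_(1 <= j < p.+1) (est (affine_coord p (phi w.1) d (Z w.2)) j - phi w.1 j) ^+ 2)%:E)) => //.
    have mphi1 i : measurable_fun setT (fun w : S * T => phi w.1 i).
      by apply: (measurableT_comp (mphi i)); exact: measurable_fst.
    apply: mF => //; apply: measurable_affine_coord => // i.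
    by apply: (measurableT_comp (mZ i)); exact: measurable_snd.
  + by move=> x; exact: integral_ge0.
  have mG : measurable_fun setT (fun w : T * T =>
      (\sum_(1 <= j < p.+1) (est (X w) j - th w j) ^+ 2)%:E) by exact: mF.
  rewrite (fubini_tonelli1 _ mG); last by move=> w; exact: F0.
  apply: eq_integral => t _; apply: eq_integral => t' _.
  congr EFin; apply: eq_bigr => j _; congr ((est _ _ - _) ^+ 2).
  by apply/funext => i; rewrite /X /th /U /affine_coord/=; case: ifP => ip; rewrite ?ip !add0r ?addr0.
- move=> j jp; split.
    have -> : (fun w => (th w j ^+ 2)%:E) = (fun w => (g j)%:E * (Z w.1 j ^+ 2)%:E)%E.
      by apply/funext => w; rewrite thE// exprMn sqr_sqrtr ?g0.
    apply: integrableZl => //.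
    exact: (integrable_comp_fst P (u := fun t => Z t j ^+ 2) (iZ j jp)).
  have -> : (fun w => (U w j ^+ 2)%:E) = (fun w => (d j)%:E * (Z w.2 j ^+ 2)%:E)%E.
    by apply/funext => w; rewrite UE// exprMn sqr_sqrtr ?d0.
  apply: integrableZl => //.
  exact: (integrable_comp_snd P (u := fun t => Z t j ^+ 2) (iZ j jp)).
- move=> j jp.
  have -> : (fun w => (U w j ^+ 2)%:E) = (fun w => (d j)%:E * (Z w.2 j ^+ 2)%:E)%E.
    by apply/funext => w; rewrite UE// exprMn sqr_sqrtr ?d0.
  have iZ2 := integrable_comp_snd P (u := fun t => Z t j ^+ 2) (iZ j jp).
  rewrite integralZl// -(integral12_prod_meas1 iZ2) /fubini_F/=.
  by rewrite Z1// integral_cst//= [P _]probability_setT !mule1.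
- move=> j f f' C jp mf mf' fC f'C df cf'.
  have C0 : 0 <= C by exact: le_trans (normr_ge0 _) (fC (fun=> 0)).
  have mfX : measurable_fun setT (fun w => f (fun i => th w i + U w i)) by exact: mf.
  have mf'X : measurable_fun setT (fun w => f' (fun i => th w i + U w i)) by exact: mf'.
  have if' : (P \x P)%E.-integrable setT (fun w => (f' (fun i => th w i + U w i))%:E).
    by apply: (@integrable_bounded _ _ _ _ _ C) => // w; exact: f'C.
  have key (v : nat -> R) : 0 <= v j -> [/\
     measurable_fun setT (fun w => Num.sqrt (v j) * f' (fun i => th w i + U w i)),
     forall w (z : R), `|f (fun i => th w i + U w i)| <= C * (1 + Num.sqrt (v j)) * (1 + `|z|) &
     forall w, `|Num.sqrt (v j) * f' (fun i => th w i + U w i)| <= C * (1 + Num.sqrt (v j))].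
    move=> vj0; have s0 := sqrtr_ge0 (v j); split.
    + exact: (measurable_funM (measurable_cst (Num.sqrt (v j)))).
    + move=> w z; apply: le_trans (fC _) _; rewrite -mulrA ler_peMr//.
      by rewrite -[leLHS]mulr1 ler_pM// lerDl.
    + by move=> w; rewrite normrM (ger0_norm s0) mulrC ler_pM// lerDr.
  (* One factor [Num.sqrt (v j)] comes from the chain rule, the other from the scaling of the
     coordinate; together they give the variance [v j]. *)
  have scale (v : nat -> R) (z : T * T -> R) : 0 <= v j ->
      (P \x P)%E.-integrable setT (fun w => (z w ^+ 2)%:E) -> measurable_fun setT z ->
      (\int[P \x P]_w (z w * f (fun i => th w i + U w i))%:E =
       \int[P \x P]_w (Num.sqrt (v j) * f' (fun i => th w i + U w i))%:E)%E ->
      (\int[P \x P]_w (Num.sqrt (v j) * z w * f (fun i => th w i + U w i))%:E =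
       (v j)%:E * \int[P \x P]_w (f' (fun i => th w i + U w i))%:E)%E.
    move=> vj0 iz mz H.
    have iE : (P \x P)%E.-integrable setT (fun w => (z w * f (fun i => th w i + U w i))%:E).
      apply: (@integrable_le_sqr _ _ _ _ z _ (2 * C)) => //.
        exact: measurable_funM.
      move=> w; apply: normrM_le_sqr; apply: le_trans (fC _) _.
      by rewrite ler_peMr// lerDl.
    under eq_integral do rewrite -mulrA EFinM.
    rewrite integralZl// H; under eq_integral do rewrite EFinM.
    by rewrite integralZl// muleA -EFinM -expr2 sqr_sqrtr.
  split.
    under eq_integral do rewrite UE//.
    have [k1 k2 k3] := key d (d0 _ jp).
    apply: scale; rewrite ?d0//.
      exact: (integrable_comp_snd P (u := fun t => Z t j ^+ 2) (iZ j jp)).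
    apply: (@stein_product_snd _ _ _ _ _ P P (fun t => Z t j)
      (fun w => f (fun i => th w i + U w i))
      (fun w => Num.sqrt (d j) * f' (fun i => th w i + U w i))
      (C * (1 + Num.sqrt (d j))) (mZ j) (iZ j jp) mfX k1 (fun w => k2 w _) k3).
    move=> s.
    exact: (stein_shift (affine_coord p (fun=> 0) g (Z s)) d PZ jp mf mf' fC f'C df cf').
  under eq_integral do rewrite thE//.
  have [k1 k2 k3] := key g (g0 _ jp).
  apply: scale; rewrite ?g0//.
    exact: (integrable_comp_fst P (u := fun t => Z t j ^+ 2) (iZ j jp)).
  apply: (@stein_product_fst _ _ _ _ _ P P (fun t => Z t j)
    (fun w => f (fun i => th w i + U w i))
    (fun w => Num.sqrt (g j) * f' (fun i => th w i + U w i))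
    (C * (1 + Num.sqrt (g j))) (mZ j) (iZ j jp) mfX k1 (fun w => k2 w _) k3).
  move=> t.
  have eX s : (fun i => th (s, t) i + U (s, t) i) =
      (fun i => U (s, t) i + affine_coord p (fun=> 0) g (Z s) i).
    by apply/funext => i; rewrite addrC.
  under eq_integral do rewrite eX; under [RHS]eq_integral do rewrite eX.
  exact: (stein_shift (affine_coord p (fun=> 0) d (Z t)) g PZ jp mf mf' fC f'C df cf').
Qed.

(** * Stein identities for ridge functions *)

Lemma vset_same (R : realType) (x : nat -> R) j (y : R) : vset x j y j = y.
Proof. by rewrite /vset eqxx. Qed.

Lemma vset_other (R : realType) (x : nat -> R) i j (y : R) : i != j ->
  vset x j y i = x i.
Proof. by rewrite /vset => /negbTE ->. Qed.

(** Inversion is discontinuous at 0, so it is written as the power with exponent -1, which on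
    nonnegative reals agrees with it also at 0, where both are 0. *)
Lemma measurable_inv_ge0 (R : realType) d (T : measurableType d) (f : T -> R) :
  measurable_fun setT f -> (forall t, 0 <= f t) -> measurable_fun setT (fun t => (f t)^-1).
Proof.
move=> mf f0; rewrite (_ : (fun t => _) = (fun t => f t `^ (-1))).
  by apply: (measurableT_comp (f := @powR R ^~ (-1))) => //; exact: measurable_powR.
by apply/funext => t; rewrite powR_inv1.
Qed.

(** Used with two weightings: [b = a] for the estimator, and the standardizing weights for the
    inverse moment. *)
Definition ridge (R : realType) (p : nat) (b : nat -> R) (K : R) (x : nat -> R) : R :=
  (\sum_(1 <= i < p.+1) (b i * x i) ^+ 2 + K)^-1.

Section ridge.
Context (R : realType) (p : nat) (b : nat -> R) (K : R).
Hypothesis K0 : 0 < K.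
Implicit Types x : nat -> R.
Local Notation h := (ridge p b K).
Local Notation q x := (\sum_(1 <= i < p.+1) (b i * x i) ^+ 2).

Let q_ge0 x : 0 <= q x. Proof. by apply: sumr_ge0 => i _; exact: sqr_ge0. Qed.

Let qK_gt0 x : 0 < q x + K. Proof. by rewrite ltr_wpDl. Qed.

Lemma ridge_gt0 x : 0 < h x. Proof. by rewrite invr_gt0. Qed.

Lemma ridge_le x : h x <= K^-1.
Proof. by rewrite lef_pV2 ?posrE// lerDr. Qed.

Lemma sum_sqr_ridge x : q x * h x = 1 - K * h x.
Proof.
by apply/eqP; rewrite eq_sym subr_eq -mulrDl divff// gt_eqF.
Qed.

Lemma sqr_ridge_le1 x j : (1 <= j <= p)%N -> (b j * x j) ^+ 2 * h x <= 1.
Proof.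
move=> jp; rewrite ler_pdivrMr// mul1r.
rewrite (bigD1_seq j) ?iota_uniq ?mem_index_iota ?ltnS//= -addrA lerDl.
by rewrite addr_ge0 ?(ltW K0)// sumr_ge0// => i _; exact: sqr_ge0.
Qed.

Lemma normr_ridge_le x j : (1 <= j <= p)%N -> `|b j * x j * h x| <= 1 + K^-1.
Proof.
move=> jp; have h0 := ridge_gt0 x; rewrite normrM (gtr0_norm h0).
have := sqr_ridge_le1 x jp; have := ridge_le x; rewrite -real_normK ?num_real//.
set u := `|_| => hK uh.
have : u * h x <= (1 + u ^+ 2) * h x.
  rewrite ler_wpM2r ?(ltW h0)//; have := sqr_ge0 (u - 1); have := sqr_ge0 u; lra.
lra.
Qed.

Lemma coord_measurable_ridge : coord_measurable h.
Proof.
move=> d T phi mphi; apply: measurable_inv_ge0 => [|t]; last exact: ltW.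
apply: measurable_funD => //; apply: measurable_sum => i.
by apply: measurable_funX; apply: (measurable_funM (measurable_cst (b i)) (mphi i)).
Qed.

Let q_vset x j y : (1 <= j <= p)%N ->
  q (vset x j y) = (b j * y) ^+ 2 + \sum_(1 <= i < p.+1 | i != j) (b i * x i) ^+ 2.
Proof.
move=> jp; rewrite (bigD1_seq j) ?iota_uniq ?mem_index_iota ?ltnS//=.
rewrite /vset eqxx; congr (_ + _); apply: eq_bigr => i /negbTE ij.
by rewrite ij.
Qed.

Lemma is_derive_ridge x j (y : R) : (1 <= j <= p)%N ->
  is_derive y 1 (fun y => h (vset x j y))
    (- 2 * b j * (b j * y) * h (vset x j y) ^+ 2).
Proof.
move=> jp; pose r := \sum_(1 <= i < p.+1 | i != j) (b i * x i) ^+ 2 + K.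
have hE : (fun y => h (vset x j y)) = (fun y => ((b j * y) ^+ 2 + r)^-1).
  by apply/funext => y0; rewrite /ridge q_vset// -addrA.
have r0 : 0 < r by rewrite ltr_wpDl// sumr_ge0// => i _; exact: sqr_ge0.
have D0 : (b j * y) ^+ 2 + r != 0 by rewrite gt_eqF// ltr_wpDl// sqr_ge0.
have dD : is_derive y 1 (fun y : R => (b j * y) ^+ 2 + r) (2 * b j * (b j * y)).
  by apply: is_derive_eq; rewrite /GRing.scale/=; ring.
have dV := @is_deriveV _ (fun y : R => (b j * y) ^+ 2 + r) _ _ _ D0 dD.
have hy : h (vset x j y) = ((b j * y) ^+ 2 + r)^-1 by rewrite /ridge q_vset// -addrA.
by rewrite hE; apply: is_derive_eq; rewrite hy /GRing.scale/= exprVn; ring.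
Qed.

Lemma continuous_ridge x j : (1 <= j <= p)%N -> continuous (fun y => h (vset x j y)).
Proof.
move=> jp y; apply: differentiable_continuous; apply/derivable1_diffP.
by case: (is_derive_ridge x y jp).
Qed.

End ridge.

Section bounded_random_variable.
Context (R : realType) dO (Omega : measurableType dO) (P : probability Omega R).
Implicit Types u v : Omega -> R.

(** Closed under sums and products, so that integrability of polynomial expressions in the
    regularized quantities is immediate. *)
Definition bounded_rv u := measurable_fun setT u /\ exists C, forall w, `|u w| <= C.

Lemma bounded_rv_cst k : bounded_rv (fun=> k).
Proof. by split=> //; exists `|k|. Qed.

Lemma bounded_rvD u v : bounded_rv u -> bounded_rv v -> bounded_rv (fun w => u w + v w).
Proof.
move=> [mu [C uC]] [mv [D vD]]; split; first exact: measurable_funD.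
by exists (C + D) => w; rewrite (le_trans (ler_normD _ _))// lerD.
Qed.

Lemma bounded_rvM u v : bounded_rv u -> bounded_rv v -> bounded_rv (fun w => u w * v w).
Proof.
move=> [mu [C uC]] [mv [D vD]]; split; first exact: measurable_funM.
by exists (C * D) => w; rewrite normrM ler_pM.
Qed.

Lemma bounded_rv_integrable u : bounded_rv u -> P.-integrable setT (EFin \o u).
Proof. by move=> [mu [C uC]]; exact: integrable_bounded uC. Qed.

Lemma Rintegral_sum_index (n : nat) (f : nat -> Omega -> R) :
  (forall j, (1 <= j <= n)%N -> P.-integrable setT (EFin \o f j)) ->
  P.-integrable setT (EFin \o (fun w => \sum_(1 <= j < n.+1) f j w)) /\
  (\int[P]_w (\sum_(1 <= j < n.+1) f j w) = \sum_(1 <= j < n.+1) \int[P]_w f j w)%R.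
Proof.
elim: n => [|n IH] fi.
  rewrite (_ : (fun w => _) = fun=> 0); last by apply/funext => w; rewrite big_geq.
  by rewrite big_geq// Rintegral_cst//= mul0r; split=> //; exact: integrable0.
have [|iS ES] := IH; first by move=> j /andP[j1 jn]; apply: fi; rewrite j1 leqW.
have fn : P.-integrable setT (EFin \o f n.+1) by apply: fi; rewrite leqnn.
rewrite (_ : (fun w => _) = fun w => \sum_(1 <= j < n.+1) f j w + f n.+1 w); last first.
  by apply/funext => w; rewrite big_nat_recr.
split; first exact: integrableD iS fn.
by rewrite RintegralD// ES [RHS]big_nat_recr.
Qed.

End bounded_random_variable.

Section model.
Context (R : realType) (p : nat) (d g : nat -> R) dO (Omega : measurableType dO)
  (P : probability Omega R) (th U : Omega -> nat -> R).
Hypothesis model : bayes_model p d g P th U.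
Local Notation X := (fun w i => th w i + U w i).
Local Notation E f := (\int[P]_w f w)%R.
Local Notation integrable f := (P.-integrable setT (EFin \o f)).

Let mX i : measurable_fun setT (fun w => X w i).
Proof. by case: model => -[mth mU] _ _ _ _; exact: (measurable_funD (mth i) (mU i)). Qed.

Lemma bounded_rv_ridge b K : 0 < K -> bounded_rv (fun w => ridge p b K (X w)).
Proof.
move=> K0; split; first by apply: coord_measurable_ridge.
by exists K^-1 => w; rewrite gtr0_norm ?ridge_gt0// ridge_le.
Qed.

Lemma bounded_rv_sqr_ridge b K j : 0 < K -> (1 <= j <= p)%N ->
  bounded_rv (fun w => (b j * X w j) ^+ 2 * ridge p b K (X w)).
Proof.
move=> K0 jp; split.
  apply: measurable_funM; last by apply: coord_measurable_ridge.
  by apply: measurable_funX; exact: (measurable_funM (measurable_cst (b j)) (mX j)).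
exists 1 => w; rewrite ger0_norm ?sqr_ridge_le1//.
by rewrite mulr_ge0 ?sqr_ge0// ltW// ridge_gt0.
Qed.

(** The third identity is the sum of those for [U] and [th]: Stein's identity for the marginal law
    of the observation. *)
Lemma model_stein j (f f' : (nat -> R) -> R) (C : R) : (1 <= j <= p)%N ->
  coord_measurable f -> coord_measurable f' ->
  (forall x, `|f x| <= C) -> (forall x, `|f' x| <= C) ->
  (forall x (y : R), is_derive y 1 (fun y => f (vset x j y)) (f' (vset x j y))) ->
  (forall x, continuous (fun y => f' (vset x j y))) ->
  [/\ integrable (fun w => U w j * f (X w)),
      E (fun w => U w j * f (X w)) = d j * E (fun w => f' (X w)) &
      E (fun w => X w j * f (X w)) = (d j + g j) * E (fun w => f' (X w))].
Proof.
move=> jp mf mf' fC f'C df cf'.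
have [[mth mU] _ isq _ stein] := model.
have [ith iU] := isq j jp.
have [SU Sth] := stein j f f' C jp mf mf' fC f'C df cf'.
have mfX : measurable_fun setT (fun w => f (X w)) by exact: mf.
have mf'X : measurable_fun setT (fun w => f' (X w)) by exact: mf'.
have C0 : 0 <= C by exact: le_trans (normr_ge0 _) (fC (fun=> 0)).
have iM (z : Omega -> R) : measurable_fun setT z ->
    P.-integrable setT (fun w => (z w ^+ 2)%:E) -> integrable (fun w => z w * f (X w)).
  move=> mz iz; apply: (@integrable_le_sqr _ _ _ _ z _ (2 * C)) => //.
    exact: measurable_funM.
  move=> w; apply: normrM_le_sqr; apply: le_trans (fC _) _.
  by rewrite ler_peMr// lerDl.
have iUf := iM _ (mU j) iU; have itf := iM _ (mth j) ith.
have if' : integrable (fun w => f' (X w)).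
  by apply: bounded_rv_integrable; split=> //; exists C.
have EU : E (fun w => U w j * f (X w)) = d j * E (fun w => f' (X w)).
  by rewrite /Rintegral SU fineM// integrable_fin_num.
have Eth : E (fun w => th w j * f (X w)) = g j * E (fun w => f' (X w)).
  by rewrite /Rintegral Sth fineM// integrable_fin_num.
split=> //; rewrite mulrDl -EU -Eth addrC -RintegralD//.
by apply: eq_Rintegral => w _; rewrite mulrDl.
Qed.

Lemma stein_ridge1 b K j : 0 < K -> (1 <= j <= p)%N ->
  let h w := ridge p b K (X w) in
  [/\ integrable (fun w => U w j * (b j * X w j * h w)),
      E (fun w => U w j * (b j * X w j * h w)) =
        d j * E (fun w => b j * h w * (1 - 2 * ((b j * X w j) ^+ 2 * h w))) &
      E (fun w => X w j * (b j * X w j * h w)) =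
        (d j + g j) * E (fun w => b j * h w * (1 - 2 * ((b j * X w j) ^+ 2 * h w)))].
Proof.
move=> K0 jp h; pose r := ridge p b K.
(* Sum of a bound for the function, [1 + K^-1], and one for its derivative; the latter uses that 1 -
   2s lies in [-1, 1] for s in [0, 1]. *)
pose C := 1 + K^-1 + `|b j| * K^-1.
have bK0 : 0 <= `|b j| * K^-1 by rewrite mulr_ge0// invr_ge0 ltW.
apply: (@model_stein j (fun x => b j * x j * r x)
  (fun x => b j * r x * (1 - 2 * ((b j * x j) ^+ 2 * r x))) C) => //.
- move=> dT T phi mphi; have mr : measurable_fun setT (fun t => r (phi t)).
    exact: coord_measurable_ridge.
  exact: (measurable_funM (measurable_funM (measurable_cst (b j)) (mphi j)) mr).
- move=> dT T phi mphi; have mr : measurable_fun setT (fun t => r (phi t)).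
    exact: coord_measurable_ridge.
  apply: measurable_funM; first exact: (measurable_funM (measurable_cst (b j)) mr).
  apply: measurable_funB => //; apply: (measurable_funM (measurable_cst (2 : R))).
  apply: measurable_funM => //; apply: measurable_funX.
  exact: (measurable_funM (measurable_cst (b j)) (mphi j)).
- by move=> x; rewrite (le_trans (normr_ridge_le _ K0 _ jp))// lerDl.
- move=> x; have := sqr_ridge_le1 b K0 x jp; rewrite -/r; set s := _ * r x => s1.
  have r0 := ridge_gt0 p b K0 x; have rK := ridge_le p b K0 x.
  have s0 : 0 <= s by rewrite mulr_ge0 ?sqr_ge0// ltW.
  have K1 : 0 <= 1 + K^-1 by rewrite addr_ge0// invr_ge0 ltW.
  apply: (@le_trans _ _ (`|b j| * K^-1)); last by rewrite lerDr.
  rewrite !normrM (gtr0_norm r0) -mulrA ler_wpM2l// -[leRHS]mulr1.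
  rewrite ler_pM ?(ltW r0)// ler_norml; apply/andP; split; lra.
- move=> x y; have dr := is_derive_ridge b K0 x y jp.
  rewrite (_ : (fun y => _) = fun y => b j * y * r (vset x j y)); last first.
    by apply/funext => y0; rewrite vset_same.
  by apply: is_derive_eq; rewrite /GRing.scale/= vset_same -/r; ring.
- move=> x y; have cr := @continuous_ridge _ _ b _ K0 x j jp y.
  rewrite (_ : (fun y => _) = fun y => b j * r (vset x j y) *
     (1 - 2 * (b j * y * (b j * y) * r (vset x j y)))); last first.
    by apply/funext => y0; rewrite vset_same -expr2.
  have cb : (fun y0 : R => b j * y0) @ y --> b j * y.
    by apply: cvgM; [exact: cvg_cst|exact: cvg_id].
  apply: cvgM; first by apply: cvgM; [exact: cvg_cst|exact: cr].
  apply: cvgB; first exact: cvg_cst.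
  apply: cvgM; first exact: cvg_cst.
  by apply: cvgM; [apply: cvgM; exact: cb|exact: cr].
Qed.

(** The extra factor in coordinate [i] produces mixed moments symmetric in [i] and [j], the source
    of exchangeability. *)
Lemma stein_ridge2 b K i j : 0 < K -> (1 <= i <= p)%N -> (1 <= j <= p)%N -> i != j ->
  let h w := ridge p b K (X w) in
  E (fun w => X w j * ((b i * X w i) ^+ 2 * h w * (b j * X w j * h w))) =
    (d j + g j) * E (fun w => b j * ((b i * X w i) ^+ 2 * h w) * h w *
      (1 - 4 * ((b j * X w j) ^+ 2 * h w))).
Proof.
move=> K0 ip jp ij h; pose r := ridge p b K.
pose C := 1 + K^-1 + 3 * (`|b j| * K^-1).
have bK0 : 0 <= `|b j| * K^-1 by rewrite mulr_ge0// invr_ge0 ltW.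
have K1 : 0 <= 1 + K^-1 by rewrite addr_ge0// invr_ge0 ltW.
have [] // := @model_stein j (fun x => (b i * x i) ^+ 2 * r x * (b j * x j * r x))
  (fun x => b j * ((b i * x i) ^+ 2 * r x) * r x * (1 - 4 * ((b j * x j) ^+ 2 * r x))) C.
- move=> dT T phi mphi; have mr : measurable_fun setT (fun t => r (phi t)).
    exact: coord_measurable_ridge.
  have mb k : measurable_fun setT (fun t => b k * phi t k).
    exact: (measurable_funM (measurable_cst (b k)) (mphi k)).
  by apply: measurable_funM; apply: measurable_funM => //; apply: measurable_funX.
- move=> dT T phi mphi; have mr : measurable_fun setT (fun t => r (phi t)).
    exact: coord_measurable_ridge.
  have mb k : measurable_fun setT (fun t => (b k * phi t k) ^+ 2 * r (phi t)).
    apply: measurable_funM => //; apply: measurable_funX.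
    exact: (measurable_funM (measurable_cst (b k)) (mphi k)).
  apply: measurable_funM; last first.
    by apply: measurable_funB => //; exact: (measurable_funM (measurable_cst (4 : R)) (mb j)).
  by apply: measurable_funM => //; exact: (measurable_funM (measurable_cst (b j)) (mb i)).
- move=> x; have := sqr_ridge_le1 b K0 x ip; have := normr_ridge_le b K0 x jp.
  rewrite -/r; set s := _ ^+ 2 * r x => fK s1.
  have s0 : 0 <= s by rewrite mulr_ge0 ?sqr_ge0// ltW// ridge_gt0.
  rewrite normrM (ger0_norm s0); apply: (@le_trans _ _ (1 * (1 + K^-1))).
    by rewrite ler_pM.
  by rewrite mul1r lerDl mulr_ge0.
- move=> x; have := sqr_ridge_le1 b K0 x jp; have := sqr_ridge_le1 b K0 x ip.
  rewrite -/r; set s := _ ^+ 2 * r x; set t := (b j * _) ^+ 2 * r x => s1 t1.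
  have r0 := ridge_gt0 p b K0 x; have rK := ridge_le p b K0 x.
  have s0 : 0 <= s by rewrite mulr_ge0 ?sqr_ge0// ltW.
  have t0 : 0 <= t by rewrite mulr_ge0 ?sqr_ge0// ltW.
  apply: (@le_trans _ _ (3 * (`|b j| * K^-1))); last by rewrite lerDr.
  clearbody s t; rewrite !normrM (ger0_norm s0) (gtr0_norm r0).
  rewrite [leRHS]mulrC; apply: ler_pM => //.
  + by rewrite !mulr_ge0// ltW.
  + by rewrite -mulrA ler_wpM2l// -[leRHS]mul1r ler_pM// ltW.
  + rewrite ler_norml; apply/andP; split; lra.
- move=> x y; have dr := is_derive_ridge b K0 x y jp.
  rewrite (_ : (fun y => _) = fun y => (b i * x i) ^+ 2 * r (vset x j y) *
      (b j * y * r (vset x j y))); last first.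
    by apply/funext => y0; rewrite vset_same vset_other.
  by apply: is_derive_eq; rewrite /GRing.scale/= vset_same vset_other// -/r; ring.
- move=> x y; have cr := @continuous_ridge _ _ b _ K0 x j jp y.
  rewrite (_ : (fun y => _) = fun y => b j * ((b i * x i) ^+ 2 * r (vset x j y)) *
     r (vset x j y) * (1 - 4 * (b j * y * (b j * y) * r (vset x j y)))); last first.
    by apply/funext => y0; rewrite vset_same vset_other// -expr2.
  have cb : (fun y0 : R => b j * y0) @ y --> b j * y.
    by apply: cvgM; [exact: cvg_cst|exact: cvg_id].
  apply: cvgM.
    apply: cvgM; last exact: cr.
    by apply: cvgM; [exact: cvg_cst|apply: cvgM; [exact: cvg_cst|exact: cr]].
  apply: cvgB; first exact: cvg_cst.
  apply: cvgM; first exact: cvg_cst.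
  by apply: cvgM; [apply: cvgM; exact: cb|exact: cr].
Qed.

End model.

(** * The Bayes risk *)

Lemma eq_sum_index (R : realType) (n : nat) (F G : nat -> R) :
  (forall j, (1 <= j <= n)%N -> F j = G j) ->
  \sum_(1 <= j < n.+1) F j = \sum_(1 <= j < n.+1) G j.
Proof. by move=> FG; apply: eq_big_nat => j; exact: FG. Qed.

Section risk.
Context (R : realType) (p : nat) (d g : nat -> R) dO (Omega : measurableType dO)
  (P : probability Omega R) (th U : Omega -> nat -> R).
Hypothesis hp : (3 <= p)%N.
Hypothesis hd : forall j, (1 <= j <= p)%N -> 0 < d j.
Hypothesis hg : forall j, (1 <= j <= p)%N -> 0 <= g j.
Hypothesis model : bayes_model p d g P th U.
Local Notation X := (fun w i => th w i + U w i).
Local Notation E f := (\int[P]_w f w)%R.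
Local Notation integrable f := (P.-integrable setT (EFin \o f)).

Let s_gt0 j : (1 <= j <= p)%N -> 0 < d j + g j.
Proof. by move=> jp; rewrite ltr_wpDr ?hg// hd. Qed.

Let p3 : 3 <= p%:R :> R. Proof. by rewrite ler_nat. Qed.

(** Standardizing weights: [bN i * X w i] has unit marginal variance. *)
Let bN i := (Num.sqrt (d i + g i))^-1.

Let bN_gt0 i : (1 <= i <= p)%N -> 0 < bN i.
Proof. by move=> /s_gt0 s0; rewrite invr_gt0 sqrtr_gt0. Qed.

Let sE i : (1 <= i <= p)%N -> d i + g i = (bN i ^+ 2)^-1.
Proof. by move=> /s_gt0 s0; rewrite exprVn invrK sqr_sqrtr// ltW. Qed.

Let bI u : bounded_rv u -> integrable u. Proof. exact: bounded_rv_integrable. Qed.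

(** * Inverse moments of quadratic forms *)

Section normalized.
Context (K : R).
Hypothesis K0 : 0 < K.
Let h w := ridge p bN K (X w).
Let y j w := (bN j * X w j) ^+ 2 * h w.

Let bh : bounded_rv h. Proof. exact: (bounded_rv_ridge model). Qed.
Let by_ j : (1 <= j <= p)%N -> bounded_rv (y j).
Proof. exact: (bounded_rv_sqr_ridge model). Qed.
Let byh j : (1 <= j <= p)%N -> bounded_rv (fun w => y j w * h w).
Proof. by move=> jp; exact: bounded_rvM (by_ jp) bh. Qed.

Let sum_y w : \sum_(1 <= j < p.+1) y j w = 1 - K * h w.
Proof. by rewrite -mulr_suml sum_sqr_ridge. Qed.

Let E1 : E (fun=> 1) = 1.
Proof.
by rewrite Rintegral_cst//= mul1r [P _]probability_setT.
Qed.

Lemma integral_sqr_ridge j : (1 <= j <= p)%N ->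
  E (y j) = E h - 2 * E (fun w => y j w * h w).
Proof.
move=> jp; have [_ _] := stein_ridge1 model bN K0 jp; rewrite sE//.
have b0 := bN_gt0 jp.
rewrite (_ : E (fun w => X w j * _) = (bN j)^-1 * E (y j)); last first.
  rewrite -RintegralZl//; last exact: bI (by_ jp).
  apply: eq_Rintegral => w _; rewrite /y /h; set r := ridge _ _ _ _.
  by field; rewrite gt_eqF.
rewrite (_ : E (fun w => bN j * _ * _) = bN j * (E h - 2 * E (fun w => y j w * h w))).
  move=> H; apply: (mulfI (x := (bN j)^-1)); first by rewrite invr_eq0 gt_eqF.
  by rewrite H; field; rewrite gt_eqF.
have i2 : integrable (fun w => 2 * (y j w * h w)).
  by apply: bI; apply: bounded_rvM; [exact: bounded_rv_cst|exact: byh].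
rewrite -(RintegralZl _ _ (bI (byh jp)))// -RintegralB//; last exact: bI.
rewrite -RintegralZl//.
  by apply: eq_Rintegral => w _; rewrite /y /h; ring.
exact: integrableB (bI bh) i2.
Qed.

(** No permutation of coordinates is performed: Stein's identity in coordinate [l] turns the
    integral for [k] into E(y_k y_l) + 4 E(y_k y_l h), which is symmetric in [k] and [l]. *)
Lemma integral_sqr_ridge2_eq i j : (1 <= i <= p)%N -> (1 <= j <= p)%N ->
  E (fun w => y i w * h w) = E (fun w => y j w * h w).
Proof.
have key k l : (1 <= k <= p)%N -> (1 <= l <= p)%N -> k != l ->
    E (fun w => y k w * h w) =
      E (fun w => y k w * y l w) + 4 * E (fun w => y k w * y l w * h w).
  move=> kp lp kl; have /= := stein_ridge2 model bN K0 kp lp kl; rewrite sE//.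
  have b0 := bN_gt0 lp.
  have ykl := bounded_rvM (by_ kp) (by_ lp); have yklh := bounded_rvM ykl bh.
  rewrite (_ : E (fun w => X w l * _) = (bN l)^-1 * E (fun w => y k w * y l w)); last first.
    rewrite -RintegralZl//; last exact: bI.
    apply: eq_Rintegral => w _; rewrite /y /h; set r := ridge _ _ _ _.
    by field; rewrite gt_eqF.
  rewrite (_ : E (fun w => bN l * _ * _ * _) =
     bN l * (E (fun w => y k w * h w) - 4 * E (fun w => y k w * y l w * h w))).
    move=> H; rewrite -[LHS](subrK (4 * E (fun w => y k w * y l w * h w))); congr (_ + _).
    apply: (mulfI (x := (bN l)^-1)); first by rewrite invr_eq0 gt_eqF.
    by rewrite H; field; rewrite gt_eqF.
  have i2 : integrable (fun w => 4 * (y k w * y l w * h w)).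
    by apply: bI; apply: bounded_rvM; [exact: bounded_rv_cst|].
  rewrite -(RintegralZl _ _ (bI yklh))// -RintegralB//; last exact: bI (byh kp).
  rewrite -RintegralZl//.
    by apply: eq_Rintegral => w _; rewrite /y /h; ring.
  exact: integrableB (bI (byh kp)) i2.
move=> ip jp; case: (eqVneq i j) => [->//|ij].
rewrite (key i j)// (key j i)//; last by rewrite eq_sym.
by congr (_ + 4 * _); apply: eq_Rintegral => w _; rewrite ?(mulrC (y i w)).
Qed.

Let sum_yh : \sum_(1 <= j < p.+1) E (fun w => y j w * h w) =
  E h - K * E (fun w => h w * h w).
Proof.
have [_ <-] := Rintegral_sum_index (P := P) (n := p) (f := fun j w => y j w * h w)
  (fun j jp => bI (byh jp)).
have hh := bounded_rvM bh bh.
rewrite -RintegralZl//; last exact: bI.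
rewrite -RintegralB//; [|exact: bI|]; last first.
  by apply: bI; apply: bounded_rvM => //; exact: bounded_rv_cst.
apply: eq_Rintegral => w _; rewrite -mulr_suml sum_y; ring.
Qed.

(** Sum of [integral_sqr_ridge] over the coordinates, the [y j] adding up to [1 - K * h]. Formally,
    [K = 0] gives the inverse moment 1/(p - 2) of the chi-square law. *)
Lemma integral_ridge_identity :
  (p%:R - 2) * E h + K * E h + 2 * K * E (fun w => h w * h w) = 1.
Proof.
have [_ ES] := Rintegral_sum_index (P := P) (n := p) (f := y) (fun j jp => bI (by_ jp)).
have : \sum_(1 <= j < p.+1) E (y j) = 1 - K * E h.
  rewrite -ES -RintegralZl//; last exact: bI.
  rewrite -[X in _ = X - _]E1 -RintegralB//; last 2 first.
  - exact: bI (bounded_rv_cst _ _).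
  - by apply: bI; apply: bounded_rvM => //; exact: bounded_rv_cst.
  by apply: eq_Rintegral => w _; rewrite sum_y.
have -> : \sum_(1 <= j < p.+1) E (y j) =
    p%:R * E h - 2 * (E h - K * E (fun w => h w * h w)).
  rewrite -sum_yh mulr_sumr.
  rewrite (eq_sum_index (fun j jp => integral_sqr_ridge jp)) sumrB.
  by rewrite big_const_nat subSS subn0 iter_addr addr0 mulr_natl.
lra.
Qed.

(** By exchangeability the weights enter only through their sum. *)
Lemma integral_weighted_sqr_ridge (om : nat -> R) :
  p%:R * \sum_(1 <= j < p.+1) om j * E (fun w => y j w * h w) =
  (\sum_(1 <= j < p.+1) om j) * (E h - K * E (fun w => h w * h w)).
Proof.
have p1 : (1 <= 1 <= p)%N by rewrite (leq_trans _ hp).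
have eqE j : (1 <= j <= p)%N -> E (fun w => y j w * h w) = E (fun w => y 1 w * h w).
  by move=> jp; exact: integral_sqr_ridge2_eq.
rewrite -sum_yh (eq_sum_index eqE) big_const_nat subSS subn0 iter_addr addr0 mulrnAr -[RHS]mulr_natl.
congr (_ * _); rewrite mulr_suml.
by apply: eq_big_nat => j jp; rewrite eqE.
Qed.

(* Jensen's inequality for the exchangeable weights [y j], through the tangent
   [1 / S >= 2 t h - t ^ 2 S h ^ 2] of [1 / S] at [1 / (t h)]. *)
Lemma integral_ridge_ge (a : nat -> R) :
  let W := \sum_(1 <= j < p.+1) (d j + g j) * a j ^+ 2 in
  0 < W ->
  p%:R / W * E h <= E (fun w => ridge p a (K * (W / p%:R)) (X w)).
Proof.
move=> W W0; have p0 : 0 < p%:R :> R by rewrite ltr0n (leq_trans _ hp).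
pose t := p%:R / W; have t0 : 0 < t by rewrite divr_gt0.
pose e := K * (W / p%:R); have e0 : 0 < e by rewrite mulr_gt0// divr_gt0.
pose om j := (d j + g j) * a j ^+ 2.
have hh := bounded_rvM bh bh.
have byhom j : (1 <= j <= p)%N -> bounded_rv (fun w => om j * (y j w * h w)).
  by move=> jp; apply: bounded_rvM; [exact: bounded_rv_cst|exact: byh].
have [iS ES] := Rintegral_sum_index (P := P) (n := p)
  (f := fun j w => om j * (y j w * h w)) (fun j jp => bI (byhom j jp)).
have := integral_weighted_sqr_ridge om.
have -> : \sum_(1 <= j < p.+1) om j * E (fun w => y j w * h w) =
    E (fun w => \sum_(1 <= j < p.+1) om j * (y j w * h w)).
  by rewrite ES; apply: eq_big_nat => j jp; rewrite RintegralZl//; exact: bI (byh jp).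
rewrite -/W => HE.
pose low w := 2 * t * h w + (- t ^+ 2) * (\sum_(1 <= j < p.+1) om j * (y j w * h w) + e * (h w * h w)).
have i1 : integrable (fun w => 2 * t * h w).
  by apply: bI; apply: bounded_rvM => //; exact: bounded_rv_cst.
have i2 : integrable (fun w => e * (h w * h w)).
  by apply: bI; apply: bounded_rvM => //; exact: bounded_rv_cst.
have i3 : integrable (fun w => \sum_(1 <= j < p.+1) om j * (y j w * h w) + e * (h w * h w)).
  exact: integrableD iS i2.
have i4 : integrable (fun w => (- t ^+ 2) * (\sum_(1 <= j < p.+1) om j * (y j w * h w) + e * (h w * h w))).
  exact: (integrableZl measurableT (- t ^+ 2) i3).
have Elow : E low = t * E h.
  rewrite /low RintegralD// RintegralZl//; last exact: bI.
  rewrite RintegralZl// RintegralD// [X in _ + _ * (_ + X)]RintegralZl//; last exact: bI.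
  have -> : E (fun w => \sum_(1 <= j < p.+1) om j * (y j w * h w)) =
      (W / p%:R) * (E h - K * E (fun w => h w * h w)).
    apply: (mulfI (lt0r_neq0 p0)); rewrite HE; field; by rewrite gt_eqF.
  rewrite /t /e; field; by rewrite !gt_eqF.
rewrite -/t -/e -Elow; apply: le_Rintegral => //.
- exact: integrableD i1 i4.
- by apply: bI; exact: (bounded_rv_ridge model).
- move=> w _; rewrite /low /ridge.
  set S := \sum_(1 <= i < p.+1) (a i * X w i) ^+ 2.
  have S0 : 0 <= S by rewrite sumr_ge0// => i _; exact: sqr_ge0.
  have D0 : 0 < S + e by rewrite ltr_wpDl.
  have -> : \sum_(1 <= j < p.+1) om j * (y j w * h w) = S * (h w * h w).
    rewrite /S mulr_suml; apply: eq_big_nat => j jp.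
    rewrite /om /y sE//; field; by rewrite gt_eqF// bN_gt0.
  rewrite -subr_ge0.
  have -> : (S + e)^-1 - (2 * t * h w + - t ^+ 2 * (S * (h w * h w) + e * (h w * h w))) =
      (S + e) * ((S + e)^-1 - t * h w) ^+ 2 by field; rewrite gt_eqF.
  by rewrite mulr_ge0 ?sqr_ge0// ltW.
Qed.

End normalized.

Let hseq n w := ridge p bN (2^-1 ^+ n) (X w).

(** The difficulty is the term K E(h^2) in [integral_ridge_identity]: E(1/N^2) is infinite for p = 3
    and 4, so no direct bound gives convergence to 0. Halving [K] increases h by at least K h^2 / 2,
    so this term is at most twice an increment of the bounded monotone sequence E h, and such
    increments tend to 0. *)
Lemma integral_ridge_cvg : exists2 L : R, 1 <= (p%:R - 2) * L &
  (fun n => E (hseq n)) @ \oo --> L.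
Proof.
have K0 n : 0 < 2^-1 ^+ n :> R by rewrite exprn_gt0// invr_gt0.
have p2 : 1 <= p%:R - 2 :> R by have := p3; lra.
have bh n : bounded_rv (hseq n) by exact: (bounded_rv_ridge model).
have bhh n : bounded_rv (fun w => hseq n w * hseq n w) by exact: bounded_rvM.
have h0 n w : 0 <= hseq n w by rewrite ltW// ridge_gt0.
have Eh0 n : 0 <= E (hseq n) by apply: Rintegral_ge0 => w _.
have Ehh0 n : 0 <= E (fun w => hseq n w * hseq n w).
  by apply: Rintegral_ge0 => w _; rewrite mulr_ge0.
have id_ n := integral_ridge_identity (K0 n).
have step n : 2^-1 ^+ n * E (fun w => hseq n w * hseq n w) <=
    2 * (E (hseq n.+1) - E (hseq n)).
  rewrite -RintegralB//; [|exact: bI|exact: bI].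
  rewrite -!RintegralZl//; [|exact: integrableB (bI (bh _)) (bI (bh _))|exact: bI].
  apply: le_Rintegral => //.
  - by apply: bI; apply: bounded_rvM; [exact: bounded_rv_cst|].
  - exact: (integrableZl measurableT (2 : R)
      (integrableB measurableT (bI (bh n.+1)) (bI (bh n)))).
  move=> w _; rewrite /hseq /ridge exprS.
  set N := \sum_(1 <= i < p.+1) (bN i * X w i) ^+ 2; set k := 2^-1 ^+ n.
  have N0 : 0 <= N by rewrite sumr_ge0// => i _; exact: sqr_ge0.
  have k0 : 0 < k by exact: K0.
  have A0 : 0 < N + k by rewrite ltr_wpDl.
  have B0 : 0 < N + 2^-1 * k by rewrite ltr_wpDl// mulr_gt0// invr_gt0.
  rewrite -subr_ge0.
  have -> : 2 * ((N + 2^-1 * k)^-1 - (N + k)^-1) - k * ((N + k)^-1 * (N + k)^-1) =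
    2^-1 * k ^+ 2 * ((N + 2^-1 * k)^-1 * ((N + k)^-1 * (N + k)^-1)).
    field; rewrite !gt_eqF//=; lra.
  by rewrite !mulr_ge0 ?invr_ge0 ?sqr_ge0// ltW.
have ndE : nondecreasing_seq (fun n => E (hseq n)).
  apply/nondecreasing_seqP => n; rewrite -subr_ge0.
  have := step n; have : 0 <= 2^-1 ^+ n * E (fun w => hseq n w * hseq n w).
    by rewrite mulr_ge0// ltW.
  lra.
have ubE n : E (hseq n) <= 1.
  have := id_ n; rewrite -/(hseq n).
  have : 0 <= 2^-1 ^+ n * E (hseq n) by rewrite mulr_ge0// ltW.
  have : 0 <= 2 * 2^-1 ^+ n * E (fun w => hseq n w * hseq n w).
    by rewrite mulr_ge0// mulr_ge0// ltW.
  have : E (hseq n) <= (p%:R - 2) * E (hseq n) by rewrite ler_peMl.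
  rewrite /hseq; lra.
have cE : cvgn (fun n => E (hseq n)).
  apply: nondecreasing_is_cvgn => //; exists 1 => _ [n _ <-]; exact: ubE.
exists (limn (fun n => E (hseq n))); last exact: cE.
set L := limn _.
have cL : (fun n => E (hseq n)) @ \oo --> L by exact: cE.
have cL1 : (fun n => E (hseq n.+1)) @ \oo --> L.
  by rewrite (cvg_shiftS (fun n => E (hseq n))).
have ck : (fun n => 2^-1 ^+ n : R) @ \oo --> (0 : R).
  by apply: cvg_expr; rewrite ger0_norm ?invr_ge0// invf_lt1// ltr1n.
have -> : (p%:R - 2) * L = (p%:R - 2) * L + 0 * L + 4 * (L - L).
  by rewrite subrr mul0r mulr0 !addr0.
have cR : (fun n => (p%:R - 2) * E (hseq n) + 2^-1 ^+ n * E (hseq n) +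
    4 * (E (hseq n.+1) - E (hseq n))) @ \oo --> (p%:R - 2) * L + 0 * L + 4 * (L - L).
  apply: cvgD; first apply: cvgD; try (apply: cvgM => //; try exact: cvg_cst).
  exact: cvgB.
apply: (cvgr_to_ge cR); apply: nearW => n.
have := id_ n; have := step n; rewrite /hseq; lra.
Qed.

(** * Risk of the shrinkage estimator *)

Section shrinkage.
Context (a : nat -> R).
Let W := \sum_(1 <= j < p.+1) (d j + g j) * a j ^+ 2.
Let c := cstar p d a.
Hypothesis W0 : 0 < W.
Hypothesis c0 : 0 <= c.
Let tr := \sum_(1 <= j < p.+1) d j.

(** Here the form of [cstar] is explained. The weights z_j sum to at most 1, so the second-order
    Stein term is at most 4 c M with M = max d_j a_j; since sum d_j a_j = c + 2 M, the coefficient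
    of h is at most -2 c (c + 2 M) + 4 c M + c^2 = -c^2. *)
Lemma regularized_risk_le (e : R) : 0 < e ->
  let h w := ridge p a e (X w) in
  integrable (fun w => \sum_(1 <= j < p.+1) (U w j - c * (a j * X w j * h w)) ^+ 2) /\
  E (fun w => \sum_(1 <= j < p.+1) (U w j - c * (a j * X w j * h w)) ^+ 2) <=
    tr - c ^+ 2 * E h.
Proof.
move=> e0 h; have [[mth mU] _ isq EU _] := model.
have bh : bounded_rv h by exact: (bounded_rv_ridge model).
pose z j w := (a j * X w j) ^+ 2 * h w.
have bz j : (1 <= j <= p)%N -> bounded_rv (z j) by exact: (bounded_rv_sqr_ridge model).
have bc k : bounded_rv (fun _ : Omega => k) by exact: bounded_rv_cst.
pose G j w := d j * (a j * h w * (1 - 2 * z j w)).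
have bG0 j : (1 <= j <= p)%N -> bounded_rv (fun w => a j * h w * (1 - 2 * z j w)).
  move=> jp; apply: bounded_rvM; first by apply: bounded_rvM.
  rewrite (_ : (fun w => _) = fun w => 1 + (- 2) * z j w); last first.
    by apply/funext => w; rewrite mulNr.
  by apply: bounded_rvD => //; apply: bounded_rvM => //; exact: bz.
have bzh j : (1 <= j <= p)%N -> bounded_rv (fun w => z j w * h w).
  by move=> jp; apply: bounded_rvM => //; exact: bz.
(* The integrand left after Stein's identity has removed [U] from the cross term. *)
pose V j w := (- 2 * c) * G j w + c ^+ 2 * (z j w * h w).
have bV j : (1 <= j <= p)%N -> bounded_rv (V j).
  move=> jp; apply: bounded_rvD; apply: bounded_rvM => //; last exact: bzh.
  by apply: bounded_rvM => //; exact: bG0.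
have sq j : (1 <= j <= p)%N ->
    integrable (fun w => (U w j - c * (a j * X w j * h w)) ^+ 2) /\
    E (fun w => (U w j - c * (a j * X w j * h w)) ^+ 2) = d j + E (V j).
  move=> jp; have [iUF EUF0 _] := stein_ridge1 model a e0 jp.
  have EUF : E (fun w => U w j * (a j * X w j * h w)) =
    d j * E (fun w => a j * h w * (1 - 2 * z j w)) by exact: EUF0.
  have [_ iU] := isq j jp.
  have eqf : (fun w => (U w j - c * (a j * X w j * h w)) ^+ 2) =
     fun w => U w j ^+ 2 + ((- 2 * c) * (U w j * (a j * X w j * h w)) + c ^+ 2 * (z j w * h w)).
    by apply/funext => w; rewrite /z; ring.
  have i1 : integrable (fun w => (- 2 * c) * (U w j * (a j * X w j * h w))).
    exact: (integrableZl measurableT (- 2 * c) iUF).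
  have i2 : integrable (fun w => c ^+ 2 * (z j w * h w)).
    by apply: bI; apply: bounded_rvM => //; exact: bzh.
  have i12 := integrableD measurableT i1 i2.
  rewrite eqf; split; first exact: (integrableD measurableT iU i12).
  rewrite RintegralD//; congr (_ + _); first by rewrite /Rintegral EU.
  rewrite RintegralD// [X in X + _]RintegralZl// EUF /V RintegralD//; last first.
    by apply: bI; apply: bounded_rvM => //; apply: bounded_rvM => //; exact: bG0.
  congr (_ + _); rewrite [RHS]RintegralZl//; last first.
    by apply: bI; apply: bounded_rvM => //; exact: bG0.
  by congr (_ * _); rewrite /G RintegralZl//; exact: bI (bG0 _ jp).
have [iS ES] := Rintegral_sum_index (P := P) (n := p)
  (f := fun j w => (U w j - c * (a j * X w j * h w)) ^+ 2) (fun j jp => (sq j jp).1).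
split=> //; rewrite ES (eq_sum_index (fun j jp => (sq j jp).2)) big_split/= -/tr lerD2l.
have [iV EV] := Rintegral_sum_index (P := P) (n := p) (f := V) (fun j jp => bI (bV j jp)).
rewrite -EV -mulNr -RintegralZl//; last exact: bI.
apply: le_Rintegral => //; first by apply: bI; apply: bounded_rvM.
move=> w _; have h0 : 0 < h w by exact: ridge_gt0.
have z0 j : 0 <= z j w by rewrite mulr_ge0 ?sqr_ge0// ltW.
have sz : \sum_(1 <= j < p.+1) z j w <= 1.
  rewrite /z -mulr_suml /h sum_sqr_ridge// gerBl mulr_ge0 ?(ltW e0)// ltW//.
have sdaz : \sum_(1 <= j < p.+1) d j * a j * z j w <= maxda p d a.
  apply: (@le_trans _ _ (\sum_(1 <= j < p.+1) maxda p d a * z j w)).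
    by apply: ler_sum_indexn => j jp; rewrite ler_wpM2r// maxda_ub.
  by rewrite -mulr_sumr ler_piMr// maxda_ge0.
have -> : \sum_(1 <= j < p.+1) V j w =
   h w * (- 2 * c * (\sum_(1 <= j < p.+1) d j * a j) +
          4 * c * (\sum_(1 <= j < p.+1) d j * a j * z j w) +
          c ^+ 2 * \sum_(1 <= j < p.+1) z j w).
  rewrite !mulr_sumr -!big_split/= mulr_sumr; apply: eq_bigr => j _.
  by rewrite /V /G; ring.
rewrite [leRHS]mulrC ler_wpM2l ?(ltW h0)//.
have -> : \sum_(1 <= j < p.+1) d j * a j = c + 2 * maxda p d a by rewrite /c /cstar; ring.
have : 4 * c * (\sum_(1 <= j < p.+1) d j * a j * z j w) <= 4 * c * maxda p d a.
  by rewrite ler_wpM2l// mulr_ge0.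
have : c ^+ 2 * \sum_(1 <= j < p.+1) z j w <= c ^+ 2 * 1.
  by rewrite ler_wpM2l// sqr_ge0.
lra.
Qed.

Lemma coord_measurable_delta j : coord_measurable (fun x => delta p d a x j).
Proof.
move=> dT T phi mphi; rewrite /delta.
have ma i : measurable_fun setT (fun t => a i * phi t i).
  exact: (measurable_funM (measurable_cst (a i)) (mphi i)).
apply: measurable_funB => //; apply: measurable_funM => //.
apply: (measurable_funM (measurable_cst c)); apply: measurable_inv_ge0.
  by apply: measurable_sum => i; exact: measurable_funX.
by move=> t; rewrite sumr_ge0// => i _; exact: sqr_ge0.
Qed.

(* At [S = 0] all the [a j * x j] vanish, so the junk value [c / 0 = 0] in
   [delta] is the limit of the regularized estimators there too. *)
Lemma delta_cvg (e : nat -> R) x j : (1 <= j <= p)%N -> (forall n, 0 < e n) ->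
  e @ \oo --> (0 : R) ->
  (fun n => x j - c * (a j * x j * ridge p a (e n) x)) @ \oo --> delta p d a x j.
Proof.
move=> jp e0 ce; rewrite /delta -/c; set S := \sum_(1 <= i < p.+1) (a i * x i) ^+ 2.
apply: cvgB; first exact: cvg_cst.
rewrite -mulrA; apply: cvgM; first exact: cvg_cst.
have [Sz|Sn] := eqVneq S 0.
  have : S == 0 by rewrite Sz.
  rewrite /S big_nat psumr_eq0; last by move=> i _; exact: sqr_ge0.
  move/allP/(_ j); rewrite mem_index_iota ltnS jp => /(_ isT)/=.
  rewrite sqrf_eq0 => /eqP ->; rewrite mulr0.
  by under eq_fun do rewrite mul0r; exact: cvg_cst.
rewrite [S^-1 * _]mulrC; apply: cvgM; first exact: cvg_cst.
rewrite /ridge; apply: cvgV => //; rewrite -[X in _ --> X]addr0.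
by apply: cvgD => //; exact: cvg_cst.
Qed.

Lemma bayes_risk_delta_le :
  (bayes_risk p d g (delta p d a) <= (tr - p%:R / (p%:R - 2) * (c ^+ 2 / W))%:E)%E.
Proof.
have [[mth mU] riskE _ _ _] := model.
rewrite riskE; last by move=> j; exact: coord_measurable_delta.
have p0 : 0 < p%:R :> R by rewrite ltr0n (leq_trans _ hp).
have p2 : 0 < p%:R - 2 :> R by have := p3; lra.
(* The factor [W / p%:R] matches [integral_ridge_ge] at [K = 2^-1 ^+ n]: with it the terms in E(h^2)
   cancel exactly in the Jensen bound. *)
pose e n : R := 2^-1 ^+ n * (W / p%:R).
have k0 n : 0 < 2^-1 ^+ n :> R by rewrite exprn_gt0// invr_gt0.
have e0 n : 0 < e n by rewrite mulr_gt0// divr_gt0.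
have ce : e @ \oo --> (0 : R).
  rewrite -(mul0r (W / p%:R)); apply: cvgM; last exact: cvg_cst.
  by apply: cvg_expr; rewrite ger0_norm ?invr_ge0// invf_lt1// ltr1n.
pose F n w := \sum_(1 <= j < p.+1) (U w j - c * (a j * X w j * ridge p a (e n) (X w))) ^+ 2.
have FE n w : F n w = \sum_(1 <= j < p.+1)
    (X w j - c * (a j * X w j * ridge p a (e n) (X w)) - th w j) ^+ 2.
  by apply: eq_bigr => j _; congr (_ ^+ 2); ring.
have cF w : (fun n => (F n w)%:E) @ \oo -->
    (\sum_(1 <= j < p.+1) (delta p d a (X w) j - th w j) ^+ 2)%:E.
  apply/fine_cvgP; split; first exact: nearW.
  rewrite (_ : fine \o _ = fun n => \sum_(1 <= j < p.+1)
    (X w j - c * (a j * X w j * ridge p a (e n) (X w)) - th w j) ^+ 2); last first.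
    by apply/funext => n /=; rewrite FE.
  rewrite big_nat; under eq_fun do rewrite big_nat.
  apply: cvg_big => [|j jp]; first exact: add_continuous.
  rewrite expr2; under eq_fun do rewrite expr2.
  have cj : (fun n => X w j - c * (a j * X w j * ridge p a (e n) (X w)) - th w j) @ \oo -->
      delta p d a (X w) j - th w j.
    by apply: cvgB; [exact: delta_cvg|exact: cvg_cst].
  by apply: cvgM.
have mF n : measurable_fun setT (fun w => (F n w)%:E).
  by have [iF _] := regularized_risk_le (e0 n); exact: measurable_int iF.
have F0 n w : (0 <= (F n w)%:E)%E.
  by rewrite lee_fin sumr_ge0// => j _; exact: sqr_ge0.
have := fatou P measurableT mF (fun n w _ => F0 n w).
rewrite (_ : (\int[P]_w limn_einf _)%E = (\int[P]_w
    (\sum_(1 <= j < p.+1) (delta p d a (X w) j - th w j) ^+ 2)%:E)%E); last first.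
  by apply: eq_integral => w _; rewrite (cvg_limn_einf_sup (cF w)).1.
move=> /le_trans; apply.
have [L L1 cL] := integral_ridge_cvg.
pose v n := tr - c ^+ 2 * (p%:R / W * E (hseq n)).
have cv : (fun n => (v n)%:E) @ \oo --> (tr - c ^+ 2 * (p%:R / W * L))%:E.
  apply/fine_cvgP; split; first exact: nearW.
  apply: cvgB; first exact: cvg_cst.
  by apply: cvgM; [exact: cvg_cst|apply: cvgM; [exact: cvg_cst|exact: cL]].
apply: (@le_trans _ _ (tr - c ^+ 2 * (p%:R / W * L))%:E); last first.
  rewrite lee_fin lerD2l lerN2.
  have -> : p%:R / (p%:R - 2) * (c ^+ 2 / W) = c ^+ 2 * (p%:R / W * (p%:R - 2)^-1).
    by field; rewrite !gt_eqF.
  rewrite ler_wpM2l ?sqr_ge0// ler_wpM2l ?divr_ge0 ?(ltW p0) ?(ltW W0)//.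
  by rewrite -[leLHS]mul1r ler_pdivrMr// mulrC.
rewrite limn_einf_lim -(cvg_lim _ cv)//; apply: lee_lim.
- exact: is_cvg_einfs.
- by apply/cvg_ex; eexists; exact: cv.
- apply: nearW => n; apply: (@le_trans _ _ (\int[P]_w (F n w)%:E)%E).
    by apply: ereal_inf_lbound; exists n => //=.
  have [iF EF] := regularized_risk_le (e0 n).
  rewrite -[leLHS]fineK; last exact: integrable_fin_num.
  rewrite lee_fin; apply: le_trans EF _; rewrite lerD2l lerN2.
  by rewrite ler_wpM2l ?sqr_ge0//; exact: (integral_ridge_ge (k0 n) W0).
Qed.

End shrinkage.
End risk.

(** * The bounds for nu = 3 and nu >= 4 *)

Unset Implicit Arguments.
Set Strict Implicit.

Theorem theorem3 (R : realType) (p : nat) (d g a : nat -> R) (nu : nat)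
  (hp : (3 <= p)%N)
  (hd : forall j, (1 <= j <= p)%N -> 0 < d j)
  (hg : forall j, (1 <= j <= p)%N -> 0 <= g j)
  (hsort : forall i j, (1 <= i)%N -> (i <= j)%N -> (j <= p)%N ->
             dstar d g j <= dstar d g i)
  (ha : is_maximizer p d g a)
  (hnu : is_nu p d a nu) :
  let tr := \sum_(1 <= j < p.+1) d j in
  let base := tr - \sum_(3 <= j < p.+1) dstar d g j in
  ((nu = 3)%N ->
     (bayes_risk p d g (delta p d a) <=
       (base + (dstar d g 3 - 2 / (p%:R - 2) * \sum_(4 <= j < p.+1) dstar d g j
                - p%:R / (p%:R - 2) * (dstar d g 3 / 3)))%:E)%E /\
     base + (dstar d g 3 - 2 / (p%:R - 2) * \sum_(4 <= j < p.+1) dstar d g j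
                - p%:R / (p%:R - 2) * (dstar d g 3 / 3))
       <= base + 2 / 3 * dstar d g 3) /\
  ((4 <= nu)%N ->
     (bayes_risk p d g (delta p d a) <=
       (base + (dstar d g 3 + dstar d g 4
                - 2 / (p%:R - 2) * \sum_(5 <= j < p.+1) dstar d g j
                - 4 * p%:R / (p%:R - 2) * (dstar d g nu / nu%:R)))%:E)%E /\
     base + (dstar d g 3 + dstar d g 4
                - 2 / (p%:R - 2) * \sum_(5 <= j < p.+1) dstar d g j
                - 4 * p%:R / (p%:R - 2) * (dstar d g nu / nu%:R))
       <= base + (dstar d g 3 + dstar d g 4)).
Proof.
move=> tr base.
have p3 : 3 <= p%:R :> R by rewrite ler_nat.
have k0 : 0 < p%:R - 2 :> R by lra.
have pk1 : 1 <= p%:R / (p%:R - 2) :> R by rewrite ler_pdivlMr//; lra.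
have pk0 : 0 <= p%:R / (p%:R - 2) :> R by rewrite (le_trans _ pk1).
have ik0 : 0 <= 2 / (p%:R - 2) :> R by rewrite divr_ge0// ltW.
have D0 j : (1 <= j <= p)%N -> 0 < dstar d g j.
  by move=> jp; rewrite dstar_gt0 ?hd ?hg.
have W0 := sum_dstar_gt0 R p d g hp hd hg.
have c0 := cstar_gt0 R p d g a hp hd hg ha.
have [] := cstar_maximizer R p d g a hp hd hg ha nu hsort hnu.
set W := \sum_(1 <= j < p.+1) _ in W0 *; set c := cstar p d a in c0 *.
set V := c ^+ 2 / W => VE nuQ.
have [[_ aW] _] := ha; have /andP[_ nup] := proj1 hnu.
have risk : (bayes_risk p d g (delta p d a) <= (tr - p%:R / (p%:R - 2) * V)%:E)%E.
  have [dO [T [P [th [U model]]]]] :=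
    bayes_model_exists (fun j jp => ltW (hd j jp)) hg.
  rewrite /V /W -aW.
  have W0' : 0 < \sum_(1 <= j < p.+1) (d j + g j) * a j ^+ 2 by rewrite aW.
  exact: (bayes_risk_delta_le hp hd hg model W0' (ltW c0)).
(* Each case now only needs a lower bound for [V]. *)
have bound B : B <= V -> (bayes_risk p d g (delta p d a) <=
    (tr - p%:R / (p%:R - 2) * B)%:E)%E.
  by move=> BV; apply: le_trans risk _; rewrite lee_fin lerD2l lerN2 ler_wpM2l.
have tail_ge0 m : (1 <= m)%N -> 0 <= \sum_(m <= j < p.+1) dstar d g j.
  move=> m1; rewrite big_nat sumr_ge0// => j /andP[mj jp].
  by rewrite ltW// D0// (leq_trans m1 mj).
split=> nuE.
  have D30 : 0 < dstar d g 3 by rewrite D0.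
  have s3 : \sum_(3 <= j < p.+1) dstar d g j =
      dstar d g 3 + \sum_(4 <= j < p.+1) dstar d g j by rewrite big_ltn.
  rewrite nuE in VE nuQ; split; last first.
    rewrite lerD2l; have := mulr_ge0 ik0 (tail_ge0 4 isT).
    have : 1 * (dstar d g 3 / 3) <= p%:R / (p%:R - 2) * (dstar d g 3 / 3).
      by rewrite ler_wpM2r// divr_ge0// ltW.
    lra.
  (* Since p/(p - 2) = 1 + 2/(p - 2), the coefficient of the tail splits into the part contained in
     [base] and the extra correction. *)
  rewrite (_ : base + _ = tr - p%:R / (p%:R - 2) *
      (dstar d g 3 / 3 + \sum_(4 <= j < p.+1) dstar d g j)); last first.
    by rewrite /base s3; field; rewrite gt_eqF.
  apply: bound; rewrite VE lerD2r.
  set Q := \sum_(1 <= j < 4) _.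
  have Q0 : 0 < Q.
    apply: sumr_indexn_gt0 => // j /andP[j1 j3].
    by rewrite invr_gt0 D0// j1 (leq_trans _ hp).
  (* For [nu = 3] the head contributes 1/Q, a third of the harmonic mean of the first three values,
     which is at least a third of the smallest. *)
  have -> : (3%:R - 2) ^+ 2 / Q = Q^-1 by rewrite (_ : 3%:R - 2 = 1 :> R) ?expr1n ?mul1r//; ring.
  rewrite -[leRHS]mul1r ler_pdivlMr// mulrAC ler_pdivrMr// mul1r mulr_sumr.
  apply: (@le_trans _ _ (\sum_(1 <= j < 4) 1)).
    apply: ler_sum_indexn => j /andP[j1 j3].
    by rewrite ler_pdivrMr ?mul1r ?hsort// D0// j1 (leq_trans _ hp).
  by rewrite big_const_nat iter_addr addr0.
have p4 : (4 <= p)%N by exact: leq_trans nup.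
have n0 : 0 < nu%:R :> R by rewrite ltr0n (leq_trans _ nuE).
have Dnu0 : 0 < dstar d g nu by rewrite D0// nup (leq_trans _ nuE).
have s3 : \sum_(3 <= j < p.+1) dstar d g j =
    dstar d g 3 + dstar d g 4 + \sum_(5 <= j < p.+1) dstar d g j.
  by rewrite big_ltn// big_ltn ?addrA.
split; last first.
  rewrite lerD2l; have := mulr_ge0 ik0 (tail_ge0 5 isT).
  have : 0 <= 4 * p%:R / (p%:R - 2) * (dstar d g nu / nu%:R).
    by rewrite -mulrA -mulrA mulr_ge0// mulrA mulr_ge0// divr_ge0// ltW.
  lra.
rewrite (_ : base + _ = tr - p%:R / (p%:R - 2) *
    (4 * (dstar d g nu / nu%:R) + \sum_(5 <= j < p.+1) dstar d g j)); last first.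
  by rewrite /base s3; field; rewrite !gt_eqF.
(* The sum from 5 is cut after [nu], its second piece being the tail of [V]; the first piece is
   empty when [nu = 4]. *)
apply: bound; rewrite VE (big_cat_nat (n := nu.+1))//= addrA lerD2r.
apply: sorted_sum_le_harmonic => //.
- by move=> j /andP[j1 jn]; rewrite D0// j1 (leq_trans jn).
- by move=> i j i1 ij jn; rewrite hsort// (leq_trans jn).
Qed.
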